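(* Let $p$ be a prime and $n\ge1$. The simplex ${\rm IRS}_\tau(\mathcal{A}_{n,p})$ of shift-invariant Borel probability measures on ${\rm Sub}(\mathcal{A}_{n,p})$ is a Poulsen simplex. Therefore ${\rm IRS}_0(\mathcal{L}_{n,p})={\rm IRS}_\ast(\mathcal{L}_{n,p})$ is also a Poulsen simplex.
   Context: $\mathcal{A}_{n,p}=\bigoplus_{\mathbb{Z}}(\mathbb{Z}/p\mathbb{Z})^n$ and $\mathcal{L}_{n,p}=\mathcal{A}_{n,p}\rtimes\mathbb{Z}$, $\mathbb{Z}$ acting by the shift $\tau$, $(\tau\omega)_i=\omega_{i+1}$. ${\rm Sub}(G)$ is the compact space of subgroups of $G$ with the topology induced from $\{0,1\}^G$. ${\rm IRS}_\tau(\mathcal{A}_{n,p})$ is the set of Borel probability measures on ${\rm Sub}(\mathcal{A}_{n,p})$ invariant under the map $H\mapsto\tau H$, with the weak$^*$ topology. For a subgroup $V\le\mathcal{L}_{n,p}$ let $\pi_1(V)\in\{0,1,2,\dots\}$ be such that the projection of $V$ to $\mathbb{Z}$ is $\pi_1(V)\mathbb{Z}$. ${\rm IRS}_0(\mathcal{L}_{n,p})$ is the set of conjugation-invariant Borel probability measures $\mu$ on ${\rm Sub}(\mathcal{L}_{n,p})$ with $\mu(\pi_1^{-1}(0))=1$; ${\rm IRS}_\ast(\mathcal{L}_{n,p})$ is the set of conjugation-invariant Borel probability measures supported on the perfect kernel of ${\rm Sub}(\mathcal{L}_{n,p})$ (the unique perfect subset with countable complement). A Poulsen simplex is a simplex whose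 extreme points are dense. *)

(* Defs.v *)
From HB Require Import structures.
From mathcomp Require Import all_boot all_order all_algebra zify.
From mathcomp Require Import all_classical all_reals all_analysis.
Set Implicit Arguments. Unset Strict Implicit. Unset Printing Implicit Defensive.
Import Order.TTheory GRing.Theory Num.Theory.
Import numFieldTopology.Exports.
Local Open Scope classical_set_scope.
Local Open Scope ring_scope.

Definition Borel (X : ptopologicalType) := g_sigma_algebraType (@open X).

Section probs.
Variables (R : realType) (X : ptopologicalType).
Local Notation T := (Borel X).
Local Notation prob := (probability T R).

Definition weak_close (k : nat) (f : 'I_k -> X -> R) (eps : R) (mu nu : prob) :=
  forall i, (`| \int[nu]_x (f i x)%:E - \int[mu]_x (f i x)%:E | < eps%:E)%E.

Definition weak_closure (K : set prob) (mu : prob) :=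
  forall (k : nat) (f : 'I_k -> X -> R), (forall i, continuous (f i)) ->
  forall eps : R, 0 < eps -> exists nu, K nu /\ weak_close f eps mu nu.

Definition weak_dense (K K' : set prob) := forall mu, K' mu -> weak_closure K mu.

Definition convex_probs (K : set prob) :=
  forall (m1 m2 mu : prob) (t : R), K m1 -> K m2 -> 0 <= t <= 1 ->
    (forall A : set T, measurable A -> mu A = (t%:E * m1 A + (1 - t)%:E * m2 A)%E) ->
    K mu.

Definition is_extreme (K : set prob) (mu : prob) :=
  K mu /\ forall (m1 m2 : prob) (t : R), K m1 -> K m2 -> 0 < t < 1 ->
    (forall A : set T, measurable A -> mu A = (t%:E * m1 A + (1 - t)%:E * m2 A)%E) ->
    forall A : set T, measurable A -> m1 A = m2 A.

Definition in_cone (K : set prob) (nu : set T -> \bar R) :=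
  exists c : R, 0 <= c /\ exists mu : prob, K mu /\
    forall A : set T, measurable A -> nu A = (c%:E * mu A)%E.

Definition cone_le (K : set prob) (nu1 nu2 : set T -> \bar R) :=
  exists nu3, in_cone K nu3 /\
    forall A : set T, measurable A -> nu2 A = (nu1 A + nu3 A)%E.

(** Choquet simplex (Choquet--Meyer definition): a weak*-compact (= closed,
    the probability measures on a compact space being weak*-compact) convex
    set whose generated cone is a lattice in its own order. *)
Definition choquet_simplex (K : set prob) :=
  [/\ convex_probs K,
      (forall mu, weak_closure K mu -> K mu) &
      forall nu1 nu2, in_cone K nu1 -> in_cone K nu2 ->
        exists s, [/\ in_cone K s, cone_le K nu1 s, cone_le K nu2 s &
          forall u, in_cone K u -> cone_le K nu1 u -> cone_le K nu2 u ->
            cone_le K s u]].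

Definition poulsen_simplex (K : set prob) :=
  choquet_simplex K /\ weak_dense (is_extreme K) K.

Definition invariant_under (f : X -> X) (mu : prob) :=
  forall B : set T, measurable B -> mu ((f : T -> T) @^-1` B) = mu B.
End probs.

Definition Anp (n p : nat) : Type :=
  {w : int -> 'rV['F_p]_n | exists N : nat, forall i : int, (N < `|i|)%N -> w i = 0}.

Section lamp.
Variables n p : nat.
Local Notation A := (Anp n p).

Lemma Anp_zero_fin : exists N : nat, forall i : int, (N < `|i|)%N ->
  (fun _ : int => (0 : 'rV['F_p]_n)) i = 0.
Proof. by exists 0%N. Qed.
Definition Azero : A := exist _ _ Anp_zero_fin.

Lemma Anp_add_fin (x y : A) : exists N : nat, forall i : int, (N < `|i|)%N ->
  (fun i => proj1_sig x i + proj1_sig y i) i = 0.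
Proof.
case: x => x [Nx Hx]; case: y => y [Ny Hy]; exists (maxn Nx Ny) => i /= Hi.
rewrite Hx ?Hy ?addr0 //; apply: leq_ltn_trans Hi;
  [exact: leq_maxr | exact: leq_maxl].
Qed.
Definition Aadd (x y : A) : A := exist _ _ (Anp_add_fin x y).

Lemma Anp_opp_fin (x : A) : exists N : nat, forall i : int, (N < `|i|)%N ->
  (fun i => - proj1_sig x i) i = 0.
Proof. by case: x => x [N H]; exists N => i /= Hi; rewrite H ?oppr0. Qed.
Definition Aopp (x : A) : A := exist _ _ (Anp_opp_fin x).

Lemma Anp_shift_fin (k : int) (x : A) : exists N : nat, forall i : int,
  (N < `|i|)%N -> (fun i => proj1_sig x (i + k)) i = 0.
Proof.
case: x => x [N H]; exists (N + `|k|)%N => i /= Hi; apply: H.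
by move: Hi; lia.
Qed.
Definition shift (k : int) (x : A) : A := exist _ _ (Anp_shift_fin k x).

Definition is_subgroupA (H : A -> bool) :=
  [/\ H Azero, (forall x y, H x -> H y -> H (Aadd x y)) & (forall x, H x -> H (Aopp x))].

(** The lamplighter group L_{n,p} = A_{n,p} >| Z, with Z acting by tau:
    (w, k) (w', k') = (w + tau^k w', k + k'). *)
Definition Lnp : Type := (A * int)%type.
Definition Lone : Lnp := (Azero, 0).
Definition Lmul (g h : Lnp) : Lnp := (Aadd g.1 (shift g.2 h.1), g.2 + h.2).
Definition Linv (g : Lnp) : Lnp := (Aopp (shift (- g.2) g.1), - g.2).

Definition is_subgroupL (V : Lnp -> bool) :=
  [/\ V Lone, (forall x y, V x -> V y -> V (Lmul x y)) & (forall x, V x -> V (Linv x))].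
End lamp.

Definition SpA (n p : nat) := prod_topology (fun _ : Anp n p => bool).
Definition SpL (n p : nat) := prod_topology (fun _ : Lnp n p => bool).
HB.instance Definition _ (n p : nat) := Pointed.on (SpA n p).
HB.instance Definition _ (n p : nat) := Nbhs.on (SpA n p).
HB.instance Definition _ (n p : nat) := Topological.on (SpA n p).
HB.instance Definition _ (n p : nat) := Pointed.on (SpL n p).
HB.instance Definition _ (n p : nat) := Nbhs.on (SpL n p).
HB.instance Definition _ (n p : nat) := Topological.on (SpL n p).

Definition SubA (n p : nat) : set (SpA n p) := [set H | is_subgroupA H].
Definition SubL (n p : nat) : set (SpL n p) := [set V | is_subgroupL V].

(** The shift on Sub(A): H |-> tau H, i.e. (tau H)(w) = H(tau^{-1} w). *)
Definition tauS (n p : nat) (H : SpA n p) : SpA n p := fun w => H (shift (-1) w).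

(** Conjugation on Sub(L): V |-> g V g^{-1}, i.e. (g V g^{-1})(x) = V(g^{-1} x g). *)
Definition conjS (n p : nat) (g : Lnp n p) (V : SpL n p) : SpL n p :=
  fun x => V (Lmul (Lmul (Linv g) x) g).

Definition pi1_zero (n p : nat) : set (SpL n p) := [set V | forall x, V x -> x.2 = 0].

Definition is_perfect_kernel (n p : nat) (K : set (SpL n p)) :=
  [/\ K `<=` @SubL n p, perfect_set K & countable (@SubL n p `\` K)].

Section IRS.
Variables (R : realType) (n p : nat).

Definition IRS_tau : set (probability (Borel (SpA n p)) R) :=
  [set mu : probability (Borel (SpA n p)) R | mu (@SubA n p) = 1%E /\ invariant_under (@tauS n p) mu].

Definition conj_inv (mu : probability (Borel (SpL n p)) R) :=
  forall g, invariant_under (@conjS n p g) mu.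

Definition IRS_0 : set (probability (Borel (SpL n p)) R) :=
  [set mu : probability (Borel (SpL n p)) R | mu (@SubL n p) = 1%E /\ conj_inv mu /\ mu (@pi1_zero n p) = 1%E].

(** IRS_*(L_{n,p}), relative to the perfect kernel K *)
Definition IRS_star (K : set (SpL n p)) : set (probability (Borel (SpL n p)) R) :=
  [set mu : probability (Borel (SpL n p)) R | mu (@SubL n p) = 1%E /\ conj_inv mu /\ mu K = 1%E].
End IRS.

Arguments SubA : clear implicits.
Arguments SubL : clear implicits.
Arguments pi1_zero : clear implicits.
Arguments is_perfect_kernel : clear implicits.
Arguments IRS_tau : clear implicits.
Arguments IRS_0 : clear implicits.
Arguments IRS_star : clear implicits.

(* Main.v *)
(** Simplex: two finite invariant measures have a least upper bound, built from
    the Hahn decomposition of their difference; it is invariant because it is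
    least and the maps preserve total mass.  Closedness holds because Borel
    measures on these Cantor-like spaces are determined by clopen sets.

    Density of extreme points: uniform measures on finite shift orbits are
    extreme.  Given an invariant measure [mu] on Sub(A), choose subgroups
    [H_0, ..., H_(M-1)] whose empirical mean approximates the [mu]-integral of
    the Birkhoff averages over a window of length [N], cut each [H_k] down to
    the coordinates in [0, N), and take the direct sum of the translates of
    these pieces, repeated with period [M N].  The orbit of this subgroup sees
    the [H_k] except near the ends of the blocks, a proportion O(1/N).

    Perfect kernel: the subgroups of L projecting trivially to Z form a perfect
    set, and every other subgroup is finitely generated (the spaces of leading
    coefficients stabilise), so there are only countably many of those.  As
    nonempty perfect sets are locally uncountable, the perfect kernel is
    exactly Sub(A), embedded by [H |-> H x {0}], and the second statement is
    the first one transported along this embedding. *)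

Require Import Defs.
From HB Require Import structures.
From mathcomp Require Import all_boot all_order all_algebra.
From mathcomp Require Import all_classical all_reals all_analysis.
From mathcomp Require Import measurable_realfun zify ring lra.
Set Implicit Arguments. Unset Strict Implicit. Unset Printing Implicit Defensive.
Import Order.TTheory GRing.Theory Num.Theory.
Import numFieldTopology.Exports numFieldNormedType.Exports.
Local Open Scope classical_set_scope.
Local Open Scope ring_scope.
Local Notation shift := Defs.shift.

(** * Spaces with a countable family of clopen coordinates *)

Definition agree (X : Type) (c : nat -> X -> bool) (m : nat) (x y : X) :=
  forall k, (k < m)%N -> c k x = c k y.

(** Common interface to [SpA n p] and [SpL n p], where [c k] evaluates a set at the [k]-th element
    of an enumeration of the group: the cylinders fixing the first [m] coordinates form a
    neighbourhood basis. *)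
Record cantor_coords (X : ptopologicalType) (c : nat -> X -> bool) : Prop :=
  CantorCoords {
    coords_nbhs : forall (x : X) (U : set X),
      nbhs x U <-> exists m, [set y | agree c m x y] `<=` U;
    coords_compact : compact [set: X] }.

Section product_coords.
Variables (I : Type) (e : nat -> I).
Hypothesis e_surj : forall i, exists k, e k = i.
Local Notation X := (prod_topology (fun _ : I => bool)).

(** The sets containing a cylinder around [x] form a filter, so in the forward direction only
    subbasic sets, which look at a single coordinate, have to be checked. Conversely a cylinder is a
    finite intersection of preimages of open points of [bool]. *)
Lemma prod_coords_nbhs (x : X) (U : set X) :
  nbhs x U <-> exists m, [set y | agree (fun k (z : X) => z (e k)) m x y] `<=` U.
Proof.
split.
- pose N := [set U : set X | exists m,
    [set y | agree (fun k (z : X) => z (e k)) m x y] `<=` U].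
  have FN : Filter N.
    split; first by exists 0%N.
      move=> P P' [m Hm] [m' Hm']; exists (maxn m m') => y Hy; split.
        by apply: Hm => k km; apply: Hy; rewrite leq_max km.
      by apply: Hm' => k km; apply: Hy; rewrite leq_max km orbT.
    by move=> P P' PP' [m Hm]; exists m; apply: subset_trans PP'.
  case=> V [] [Q QfinP <-] [W JW Wx] VU.
  have [L Lsub VL] := QfinP _ JW; rewrite -VL in Wx.
  suff : N W by case=> m Hm; exists m => y /Hm Wy; apply: VU; exists W.
  rewrite -VL; apply: filter_bigI => M ML.
  have /set_mem [i _ [B oB BM]] := Lsub _ ML.
  have [k ki] := e_surj i; exists k.+1 => y /(_ k (ltnSn k)) /= Hk.
  by move: (Wx _ ML); rewrite -BM /= -ki Hk.
- case=> m mU; apply: filterS mU _.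
  elim: m => [|m IH]; first by apply: filterS filterT => y _ k.
  have N1 : nbhs x [set y : X | x (e m) = y (e m)].
    have /(_ x) := @proj_continuous {classic I} (fun _ => bool) (e m).
    by move/(_ [set b | x (e m) = b]); apply;
      apply: filterS (discrete_set1 _) => b ->.
  apply: filterS (filterI IH N1) => y [/= H1 H2] k.
  by rewrite ltnS leq_eqVlt => /predU1P[->//|]; apply: H1.
Qed.

Lemma prod_coords_compact : compact [set: X].
Proof.
have := @tychonoff {classic I} (fun _ => bool) (fun _ => setT)
  (fun _ => bool_compact).
by congr (compact _); apply/seteqP; split.
Qed.

End product_coords.

Lemma agree_sym (X : Type) (c : nat -> X -> bool) m x y :
  agree c m x y -> agree c m y x.
Proof. by move=> H k /H ->. Qed.

Lemma agree_trans (X : Type) (c : nat -> X -> bool) m x y z :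
  agree c m x y -> agree c m y z -> agree c m x z.
Proof. by move=> H1 H2 k km; rewrite H1 ?H2. Qed.

Lemma agreeW (X : Type) (c : nat -> X -> bool) m m' x y :
  (m <= m')%N -> agree c m' x y -> agree c m x y.
Proof. by move=> mm H k km; apply: H; apply: leq_trans km mm. Qed.

(** Under [cantor_coords] these sets are clopen, so their indicators are admissible test functions
    for the weak topology, and they form a pi-system generating the Borel sets. *)
Definition finlevel (X : Type) (c : nat -> X -> bool) : set (set X) :=
  [set B | exists m, forall x y, agree c m x y -> B x -> B y].

Section cantor.
Variables (R : realType) (X : ptopologicalType) (c : nat -> X -> bool).
Hypothesis cX : cantor_coords c.
Local Notation T := (Borel X).
Local Notation prob := (probability T R).

Lemma cantor_continuousP (Y : topologicalType) (f : X -> Y) :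
  continuous f <-> forall x U, nbhs (f x) U ->
    exists m, forall y, agree c m x y -> U (f y).
Proof.
split=> [cf x U /cf|H x U /H [m Hm]].
  by case/(coords_nbhs cX) => m Hm; exists m => y /Hm.
by apply/(coords_nbhs cX); exists m => y /Hm.
Qed.

Lemma finlevel_open B : finlevel c B -> open B.
Proof.
case=> m Hm; rewrite openE => x Bx; apply/(coords_nbhs cX); exists m => y.
by move=> xy; apply: Hm xy Bx.
Qed.

Lemma finlevelC B : finlevel c B -> finlevel c (~` B).
Proof. by case=> m Hm; exists m => x y xy nB By; apply/nB/(Hm y) => //;
  exact: agree_sym. Qed.

Lemma finlevelI : setI_closed (finlevel c).
Proof.
move=> A B [m Hm] [k Hk]; exists (maxn m k) => x y xy [Ax Bx]; split.
  by apply: Hm Ax; apply: agreeW xy; apply: leq_maxl.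
by apply: Hk Bx; apply: agreeW xy; apply: leq_maxr.
Qed.

(** An open set is the countable union over [m] of the sets of points whose [m]-cylinder it
    contains, and each of these is of finite level. *)
Lemma finlevel_borel : @measurable _ T = <<s finlevel c >>.
Proof.
apply/seteqP; split; apply: smallest_sub.
- exact: smallest_sigma_algebra.
- move=> U; rewrite openE => oU.
  have -> : U = \bigcup_m [set x | [set y | agree c m x y] `<=` U].
    apply/seteqP; split => x; last by case=> m _ /(_ x); apply.
    by move=> /oU/(coords_nbhs cX) [m Hm]; exists m.
  apply: sigma_algebra_bigcup => m; apply: sub_sigma_algebra.
  exists m => x y xy H z /= yz; apply: H; exact: agree_trans yz.
- exact: smallest_sigma_algebra.
- by move=> U /finlevel_open oU; apply: sub_sigma_algebra.
Qed.

Lemma finlevel_measurable (B : set T) : finlevel c B -> measurable B.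
Proof. by move=> ?; rewrite finlevel_borel; apply: sub_sigma_algebra. Qed.

Lemma open_borel (U : set T) : open (U : set X) -> measurable U.
Proof. by move=> ?; apply: sub_sigma_algebra. Qed.

Lemma closed_borel (C : set T) : closed (C : set X) -> measurable C.
Proof. by move=> cC; rewrite -(setCK C); apply: measurableC; apply: open_borel;
  exact: closed_openC. Qed.

Lemma measure_eq_finlevel (m1 m2 : {measure set T -> \bar R}) :
  (m1 setT < +oo)%E -> (forall B, finlevel c B -> m1 B = m2 B) ->
  forall A, measurable A -> m1 A = m2 A.
Proof.
move=> fm1 m12 A mA.
apply: (@measure_unique _ R T (finlevel c) (fun _ => setT)) => //.
- exact: finlevel_borel.
- exact: finlevelI.
- by exists 0%N.
- by rewrite bigcup_const.
Qed.

(** [B m] is the union of the [m]-cylinders that meet [C]; a point lying in all of them is adherent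
    to [C]. *)
Lemma closed_bigcap_finlevel (C : set X) : closed C ->
  exists B : nat -> set X, (forall m, finlevel c (B m)) /\ C = \bigcap_m B m.
Proof.
move=> cC; exists (fun m => [set x | exists2 y, C y & agree c m x y]).
split=> [m|]; first by exists m => x y xy [z Cz xz]; exists z => //;
  exact: agree_trans (agree_sym xy) xz.
apply/seteqP; split=> [x Cx m _|x H]; first by exists x.
apply: cC => U /(coords_nbhs cX) [m Hm]; have [y Cy /Hm Uy] := H m I.
by exists y.
Qed.

Lemma cantor_unif_continuous (q : nat) (f : 'I_q -> X -> R) (eps : R) :
  (forall i, continuous (f i)) -> 0 < eps ->
  exists m, forall i x y, agree c m x y -> `|f i x - f i y| < eps.
Proof.
move=> cf e0.
suff H1 i : exists m, forall x y, agree c m x y -> `|f i x - f i y| < eps.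
  have [g Hg] := choice H1; exists (\max_i g i)%N => i x y xy; apply: Hg.
  by apply: agreeW xy; apply: leq_bigmax.
(* Compactness as a near-covering property: it suffices to find around each point a cylinder on
   which all large [m] work. Continuity at the centre with [eps / 2] provides it. *)
have := coords_compact cX; rewrite compact_near_coveringP.
move=> /(_ nat \oo (fun m x => forall y, agree c m x y -> `|f i x - f i y| < eps)).
case=> [x _|m _ Hm]; last by exists m => x y xy; apply: (Hm m) xy => //=.
have [m Hm] : exists m, forall y, agree c m x y -> `|f i x - f i y| < eps / 2.
  have /cantor_continuousP /(_ x (ball (f i x) (eps/2))) := cf i.
  by case=> [|m Hm]; [apply: nbhsx_ballx; rewrite divr_gt0|exists m].
exists ([set y | agree c m x y], [set k | (m <= k)%N]).
  by split; [apply/(coords_nbhs cX); exists m|exists m].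
move=> [x' k] [/= xx' mk] y x'y.
have -> : f i x' - f i y = (f i x - f i y) - (f i x - f i x') by ring.
apply: le_lt_trans (ler_normB _ _) _; rewrite [ltRHS]splitr ltrD //; apply: Hm => //.
by apply: agree_trans xx' (agreeW mk x'y).
Qed.

Lemma cantor_bounded (f : X -> R) : continuous f ->
  exists2 B : R, 0 <= B & forall x, `|f x| <= B.
Proof.
move=> cf; have := continuous_compact (continuous_subspaceT cf) (coords_compact cX).
move=> /compact_bounded [B [_ HB]]; exists (`|B| + 1) => [|x];
  first by rewrite addr_ge0.
by apply: HB; [rewrite ltr_pwDr // ler_norm|exists x].
Qed.

Lemma cantor_bounded_family (q : nat) (f : 'I_q -> X -> R) :
  (forall i, continuous (f i)) ->
  exists2 B : R, 0 <= B & forall i x, `|f i x| <= B.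
Proof.
move=> cf.
have H i : exists b : R, 0 <= b /\ forall x, `|f i x| <= b.
  by have [b b0 fb] := cantor_bounded (cf i); exists b.
have [bd Hbd] := choice H.
exists (\sum_i bd i) => [|i x]; first by apply: sumr_ge0 => i _; case: (Hbd i).
apply: le_trans (proj2 (Hbd i) x) _; rewrite (bigD1 i) //= lerDl.
by apply: sumr_ge0 => j _; case: (Hbd j).
Qed.

Lemma continuous_borel (Y : ptopologicalType) (f : X -> Y) : continuous f ->
  measurable_fun setT (f : T -> Borel Y).
Proof.
move=> cf; apply: (@measurability _ _ T (Borel Y) _ _ (@open Y)) => // _ [B oB <-].
by rewrite setTI; apply: open_borel; apply: (open_comp (f := f)) => // x _; exact: cf.
Qed.

Lemma continuous_measurable_real (f : X -> R) : continuous f ->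
  measurable_fun setT (f : T -> R).
Proof.
move=> cf; apply: (measurability _ (RGenOInfty.measurableE R)) => _ [_ [a ->] <-].
rewrite setTI; apply: open_borel; apply: open_comp; first by move=> x _; exact: cf.
by apply: interval_open.
Qed.

Lemma continuous_integrable (mu : prob) (f : X -> R) : continuous f ->
  mu.-integrable setT (fun x : T => (f x)%:E).
Proof.
move=> cf; have [B B0 fB] := cantor_bounded cf.
apply: measurable_bounded_integrable => //.
- exact: fin_num_fun_lty.
- exact: continuous_measurable_real.
- exists B; split; first exact: num_real.
  by move=> r Br x _ /=; apply: le_trans (fB x) (ltW Br).
Qed.

Lemma finlevel_continuous (B : set X) : finlevel c B ->
  continuous (\1_B : X -> R).
Proof.
case=> m Hm; apply/cantor_continuousP => x U Ux; exists m => y xy.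
rewrite -(_ : \1_B x = \1_B y :> R); first exact: nbhs_singleton.
rewrite /indic; congr (_%:R); congr nat_of_bool; apply/idP/idP => /set_mem H;
  apply/mem_set.
  exact: Hm H.
by apply: Hm H; exact: agree_sym.
Qed.

End cantor.

Lemma measurable_preimage (X Y : ptopologicalType) (f : X -> Y) : continuous f ->
  forall B : set (Borel Y), measurable B ->
    measurable ((f : Borel X -> Borel Y) @^-1` B).
Proof.
by move=> cf B mB; rewrite -[X in measurable X]setTI; apply: continuous_borel.
Qed.

(** * Invariant probability measures form a simplex *)

Section realmeas.
Context d (T : measurableType d) (R : realType).
Implicit Types (h : set T -> R) (A : set T).

(** Finite measures as real-valued functions, so that differences can be formed and linear
    arithmetic applies; only the values on measurable sets are constrained. *)
Definition realmeas h := exists m : {measure set T -> \bar R},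
  forall A, measurable A -> m A = (h A)%:E.

Lemma realmeas_ge0 h A : realmeas h -> measurable A -> 0 <= h A.
Proof. by case=> m hm mA; rewrite -lee_fin -hm. Qed.

Lemma realmeasU h A P : realmeas h -> measurable A -> measurable P ->
  h A = h (A `&` P) + h (A `&` ~` P).
Proof.
case=> m hm mA mP; have mC := measurableC mP.
apply: EFin_inj; rewrite EFinD -!hm //; do ?exact: measurableI.
rewrite -measureU; do ?exact: measurableI.
  by rewrite -setIUr setUv setIT.
by rewrite setIACA setICr setI0.
Qed.

Lemma realmeas_le h A B : realmeas h -> measurable A -> measurable B ->
  A `<=` B -> h A <= h B.
Proof.
by case=> m hm mA mB AB; rewrite -lee_fin -!hm // le_measure // inE.
Qed.

Lemma realmeas_restr h P : realmeas h -> measurable P ->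
  realmeas (fun A => h (A `&` P)).
Proof.
case=> m hm mP; exists (mrestr m mP) => A mA.
by rewrite -hm //; exact: measurableI.
Qed.

Lemma realmeasD h1 h2 : realmeas h1 -> realmeas h2 ->
  realmeas (fun A => h1 A + h2 A).
Proof.
case=> [m1 hm1] [m2 hm2]; exists (measure_add m1 m2) => A mA.
by rewrite [LHS]measure_addE EFinD -hm1 // -hm2.
Qed.

Lemma realmeasZ (t : R) h : 0 <= t -> realmeas h ->
  realmeas (fun A => t * h A).
Proof.
move=> t0 [m hm]; exists (mscale (NngNum t0) m) => A mA.
by rewrite EFinM -hm.
Qed.

Lemma realmeas_fine (m : {measure set T -> \bar R}) : (m setT < +oo)%E ->
  realmeas (fun A => fine (m A)).
Proof.
move=> mT; exists m => A mA; rewrite fineK // ge0_fin_numE //.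
by apply: le_lt_trans mT; rewrite le_measure // inE.
Qed.

(** [h] is its total mass times its normalization, a probability and hence a charge. When the mass
    is zero the normalization falls back on a Dirac mass, which is then scaled by zero. *)
Lemma realmeas_charge h : realmeas h ->
  exists n : {charge set T -> \bar R}, forall A, measurable A -> n A = (h A)%:E.
Proof.
move=> rh; have [m hm] := rh; have hT := realmeas_ge0 rh measurableT.
pose P := mnormalize m (@dirac _ T point R).
exists (cscale (h setT) (charge_of_finite_measure P)) => A mA.
transitivity ((h setT)%:E * mnormalize m (@dirac _ T point R) A)%E; first by [].
rewrite /mnormalize hm // eqe orbF.
have [h0|h0] := eqVneq (h setT) 0; last by rewrite hm // -!EFinM mulrC divfK.
rewrite h0 mul0e; congr (_%:E).
by apply/eqP; rewrite eq_le realmeas_ge0 //= -h0 (realmeas_le rh).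
Qed.

(** [P] is the positive set of a Hahn decomposition of [h1 - h2], and the two measures are the
    Jordan parts of this charge. *)
Lemma hahn_realmeas h1 h2 : realmeas h1 -> realmeas h2 ->
  exists P, [/\ measurable P, realmeas (fun A => h1 (A `&` P) - h2 (A `&` P)) &
    realmeas (fun A => h2 (A `&` ~` P) - h1 (A `&` ~` P))].
Proof.
move=> /realmeas_charge [n1 H1] /realmeas_charge [n2 H2].
pose nu := cadd n1 (copp n2).
have nuE A : measurable A -> nu A = (h1 A - h2 A)%:E.
  by move=> mA; rewrite EFinB -H1 // -H2.
have [P [N PN]] := Hahn_decomposition nu.
have [[mP _] [mN _] PNT PN0] := PN.
have NE : N = ~` P.
  apply/seteqP; split=> x; first by move=> Nx Px; have : (P `&` N) x by [];
    rewrite PN0.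
  by have : (P `|` N) x by [rewrite PNT]; case.
subst N; exists P; split => //.
  exists (jordan_pos PN) => A mA.
  have mAP : measurable (A `&` P) by exact: measurableI.
  rewrite -nuE // [LHS]jordan_posE cjordan_posE /crestr0 mem_set //.
exists (jordan_neg PN) => A mA.
have mAP : measurable (A `&` ~` P) by exact: measurableI.
rewrite -opprB EFinN -nuE // [LHS]jordan_negE cjordan_negE /crestr0 mem_set //.
Qed.

End realmeas.

(** * Probabilities carried by a closed set and invariant under a family of continuous maps *)

Section simplex.
Variables (R : realType) (X : ptopologicalType) (c : nat -> X -> bool).
Hypothesis cX : cantor_coords c.
Local Notation T := (Borel X).
Local Notation prob := (probability T R).
Variables (S : set X) (G : Type) (F : G -> X -> X).
Hypotheses (cS : closed S) (cF : forall g, continuous (F g)).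

(** Both simplices have this form: [IRS_tau] with a single map indexed by [unit], [IRS_0] with all
    conjugations. *)
Definition inv_on : set prob :=
  [set mu : prob | mu S = 1%E /\ forall g, invariant_under (F g) mu].

Let mS : measurable (S : set T). Proof. exact: closed_borel. Qed.

Let mF g (A : set T) : measurable A -> measurable ((F g : T -> T) @^-1` A).
Proof. exact: (measurable_preimage (cF (g := g))). Qed.

Lemma inv_on_convex : convex_probs inv_on.
Proof.
move=> m1 m2 mu t [S1 I1] [S2 I2] t01 H; split=> [|g B mB].
  by rewrite H // S1 S2 !mule1 -EFinD addrC subrK.
by rewrite !H //; [rewrite I1 // I2|exact: mF].
Qed.

Lemma prob_fine (mu : prob) (A : set T) : measurable A ->
  mu A = (fine (mu A))%:E.
Proof. by move=> mA; rewrite fineK // fin_num_measure. Qed.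

Lemma realmeas_prob (mu : prob) : realmeas (fun A : set T => fine (mu A)).
Proof. by apply: realmeas_fine; apply: fin_num_fun_lty. Qed.

Lemma weak_closure_indic (K : set prob) (mu : prob) (q : nat)
    (B : 'I_q -> set X) : weak_closure K mu ->
  (forall i, continuous (\1_(B i) : X -> R)) ->
  (forall i, measurable (B i : set T)) ->
  forall eps : R, 0 < eps -> exists2 nu : prob, K nu &
    forall i, `|fine (nu (B i)) - fine (mu (B i))| < eps.
Proof.
move=> Kmu cB mB eps e0; have [nu [Knu H]] := Kmu _ _ cB _ e0.
exists nu => // i; move: (H i); rewrite !integral_indic // !setIT.
by move=> Hi; rewrite -lte_fin -abse_EFin EFinB -!prob_fine.
Qed.

Lemma prob_setC0 (mu : prob) : mu S = 1%E <-> mu (~` S) = 0%E.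
Proof.
have H : mu (~` S) = (1 - mu S)%E by exact: probability_setC.
by rewrite H (prob_fine mu) // -EFinB; split => -[E]; congr (_%:E); move: E; lra.
Qed.

(** The complement of [S] is a countable union of clopen sets, each null for every member and so
    null for the limit. Invariance passes to the limit on clopen sets, whose preimages are clopen
    too, and extends to Borel sets by uniqueness of measures. *)
Lemma inv_on_closed mu : weak_closure inv_on mu -> inv_on mu.
Proof.
move=> Hmu; split.
  apply/prob_setC0.
  have [B [fB SE]] := closed_bigcap_finlevel cX cS.
  have mB m : measurable (~` (B m) : set T).
    by apply: (finlevel_measurable cX); exact: finlevelC.
  have B0 m : mu (~` (B m)) = 0%E.
    rewrite (prob_fine mu) //; congr (_%:E).
    apply: contrapT => /eqP; rewrite -normr_gt0 => H.
    have [] := @weak_closure_indic inv_on mu 1 (fun _ => ~` B m) Hmu _ _ _ H.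
    - by move=> i; apply: (finlevel_continuous cX); exact: finlevelC.
    - by [].
    move=> nu [/prob_setC0 nuS _] /(_ ord0).
    have -> : fine (nu (~` B m)) = 0.
      apply/eqP; rewrite eq_le; apply/andP; split; last exact: fine_ge0.
      have -> : 0 = fine (nu (~` S)) by rewrite nuS.
      apply: (realmeas_le (realmeas_prob nu)) => //; first exact: measurableC.
      by apply: subsetC; rewrite SE; exact: bigcap_inf.
    by rewrite sub0r normrN ltxx.
  have : mu.-negligible (~` S).
    rewrite SE setC_bigcap; apply: negligible_bigcup => k.
    by exists (~` B k); split; [exact: mB|exact: B0|].
  by move/negligibleP; apply; exact: measurableC.
move=> g B mB.
have mFg : measurable_fun setT (F g : T -> T) by exact: continuous_borel.
pose m2 := @pushforward _ _ T T R mu (F g).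
suff H : forall B, finlevel c B -> mu (F g @^-1` B) = mu B.
  apply: (@measure_eq_finlevel R X c cX m2 mu _ _ B mB).
    change (mu (F g @^-1` setT) < +oo)%E.
    by rewrite preimage_setT -ge0_fin_numE // fin_num_measure.
  exact: H.
move=> {mB}B fB; have mB : measurable (B : set T) by exact: (finlevel_measurable cX).
have mFB := mF g mB.
rewrite (prob_fine mu) // [RHS](prob_fine mu) //; congr (_%:E).
apply/eqP; rewrite -subr_eq0; apply: contrapT => /negP; rewrite -normr_gt0 => H.
(* Test [B] and its preimage simultaneously, with tolerance half of the supposed gap: an invariant
   [nu] gives both the same mass, a contradiction. *)
have [||nu [_ Inu] /= Hn] := @weak_closure_indic inv_on mu 2
  (fun i => if i == ord0 then B else F g @^-1` B) Hmu _ _ _ (divr_gt0 H (ltr0n _ 2)).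
- move=> i; case: ifP => _; first exact: (finlevel_continuous cX).
  have -> : \1_(F g @^-1` B) = (\1_B : X -> R) \o F g by [].
  by move=> x; apply: continuous_comp; [exact: cF|exact: (finlevel_continuous cX)].
- by move=> i; case: ifP.
- have /= H0 := Hn ord0; have /= := Hn ord_max; rewrite Inu //.
  set a := fine (nu B) in H0 *; set u := fine (mu B) in H H0 *.
  set v := fine _ in H H0 * => H1.
  have := ler_normD (v - a) (a - u); rewrite (_ : v - a + (a - u) = v - u);
    last by ring.
  by rewrite (distrC v a); move: H0 H1; lra.
Qed.

(** Real-valued form of the elements of the cone over [inv_on]; being carried by [S] is expressed by
    vanishing off [S], which is stable under scaling and addition. *)
Definition conefun (h : set T -> R) :=
  [/\ realmeas h, h (~` S) = 0 &
    forall g (A : set T), measurable A -> h ((F g : T -> T) @^-1` A) = h A].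

Lemma in_cone_conefun nu : in_cone inv_on nu ->
  exists2 h, conefun h & forall A : set T, measurable A -> nu A = (h A)%:E.
Proof.
case=> t [t0 [mu [[muS Imu] nuE]]]; exists (fun A => t * fine (mu A)).
  split; first by apply: realmeasZ => //; exact: realmeas_prob.
    by move/prob_setC0: muS => ->; rewrite mulr0.
  by move=> g A mA; rewrite Imu.
by move=> A mA; rewrite nuE // EFinM -prob_fine.
Qed.

(** Divide by the total mass. The member [mu0] serves the zero function, which has to be written as
    zero times some element of [inv_on]. *)
Lemma conefun_in_cone (mu0 : prob) (nu : set T -> \bar R) h : inv_on mu0 ->
  conefun h -> (forall A : set T, measurable A -> nu A = (h A)%:E) ->
  in_cone inv_on nu.
Proof.
move=> K0 hh nuE; have [rh hS hI] := hh; have [m hm] := rh.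
have hT := realmeas_ge0 rh measurableT.
exists (h setT); split => //.
have [h0|h0] := eqVneq (h setT) 0.
  exists mu0; split => // A mA; rewrite nuE // h0 mul0e; congr (_%:E).
  apply/eqP; rewrite eq_le realmeas_ge0 // andbT -h0.
  exact: (realmeas_le rh).
have E A : measurable A -> mnormalize m mu0 A = (h A / h setT)%:E.
  by move=> mA; rewrite /mnormalize hm // eqe (negbTE h0) /= hm.
exists (mnormalize m mu0); split => [|A mA]; last first.
  by rewrite nuE // [X in (_ * X)%E]E // -EFinM mulrC divfK.
split=> [|g B mB]; last by rewrite [LHS]E ?[RHS]E ?hI //; exact: mF.
by apply/prob_setC0; rewrite [LHS]E ?hS ?mul0r //; exact: measurableC.
Qed.

Lemma conefunD h1 h2 : conefun h1 -> conefun h2 ->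
  conefun (fun A => h1 A + h2 A).
Proof.
case=> [r1 S1 I1] [r2 S2 I2]; split; first exact: realmeasD.
  by rewrite S1 S2 addr0.
by move=> g A mA; rewrite I1 ?I2.
Qed.

Lemma conefun_null h (A : set T) : conefun h -> measurable A ->
  (A : set X) `<=` ~` S -> h A = 0.
Proof.
case=> r hS _ mA AS; apply/eqP; rewrite eq_le realmeas_ge0 // andbT -hS.
by apply: (realmeas_le r) => //; exact: measurableC.
Qed.

(* By minimality [j] only grows under [F g]; the total mass being preserved,
   it is invariant. *)
Lemma conefun_pos_part h1 h2 P : conefun h1 -> conefun h2 -> measurable P ->
  let j := fun A : set T => h1 (A `&` P) - h2 (A `&` P) in
  realmeas j -> realmeas (fun A => h2 (A `&` ~` P) - h1 (A `&` ~` P)) ->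
  conefun j.
Proof.
move=> c1 c2 mP j rj rn; have [r1 S1 I1] := c1; have [r2 S2 I2] := c2.
have mPC := measurableC mP; have mSC := measurableC mS.
split => //.
  by rewrite /j !conefun_null ?subrr //; exact: measurableI.
have le_j (A : set T) : measurable A -> h1 A - h2 A <= j A.
  move=> mA; rewrite (realmeasU r1 mA mP) (realmeasU r2 mA mP) /j.
  by have := realmeas_ge0 rn mA; lra.
have jF g (A : set T) : measurable A -> j A <= j (F g @^-1` A).
  move=> mA; have mAP := measurableI _ _ mA mP.
  have -> : j A = h1 (F g @^-1` (A `&` P)) - h2 (F g @^-1` (A `&` P)).
    by rewrite I1 // I2.
  apply: le_trans (le_j _ (mF g mAP)) _.
  by apply: (realmeas_le rj) => //; try exact: mF; move=> x [].
move=> g A mA; have mAC := measurableC mA.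
have := jF g _ mA; have := jF g _ mAC.
have := realmeasU rj measurableT mA; have := realmeasU rj measurableT (mF g mA).
by rewrite !setTI preimage_setC; lra.
Qed.

(** The least upper bound is [h1] plus the positive part of [h2 - h1]; it equals [h1] on [P] and
    [h2] off [P]. *)
Lemma inv_on_simplex : choquet_simplex inv_on.
Proof.
split; [exact: inv_on_convex|exact: inv_on_closed|].
move=> nu1 nu2 N1 N2.
have [h1 c1 E1] := in_cone_conefun N1; have [h2 c2 E2] := in_cone_conefun N2.
have [mu0 K0] : exists mu0, inv_on mu0 by case: N1 => t [_ [mu [? _]]]; exists mu.
have [r1 S1 I1] := c1; have [r2 S2 I2] := c2.
have [P [mP rp rn]] := hahn_realmeas r1 r2.
have mPC := measurableC mP.
have cp := conefun_pos_part c1 c2 mP rp rn.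
have cn : conefun (fun A => h2 (A `&` ~` P) - h1 (A `&` ~` P)).
  by apply: conefun_pos_part => //; rewrite setCK.
pose s A := h1 A + (h2 (A `&` ~` P) - h1 (A `&` ~` P)).
have cs : conefun s by exact: conefunD.
have sE (A : set T) : measurable A -> s A = h1 (A `&` P) + h2 (A `&` ~` P).
  by move=> mA; rewrite /s (realmeasU r1 mA mP); lra.
exists (fun A => (s A)%:E); split.
- exact: conefun_in_cone K0 cs _.
- exists (fun A => (h2 (A `&` ~` P) - h1 (A `&` ~` P))%:E); split.
    exact: conefun_in_cone K0 cn _.
  by move=> A mA; rewrite E1 // -EFinD.
- exists (fun A => (h1 (A `&` P) - h2 (A `&` P))%:E); split.
    exact: conefun_in_cone K0 cp _.
  move=> A mA; rewrite E2 // -EFinD sE // (realmeasU r2 mA mP).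
  by congr (_%:E); lra.
move=> u /in_cone_conefun [hu cu Eu] [n3 [/in_cone_conefun [a ca Ea] H1]].
move=> [n4 [/in_cone_conefun [b cb Eb] H2]].
have [ra Sa _] := ca; have [rb Sb _] := cb; have [ru Su Iu] := cu.
(* The excess of [u] over [s], written as [u - h1] on [P] plus [u - h2] off [P], which shows that it
   is a measure; its invariance is read off from [u - s]. *)
pose d A := a (A `&` P) + b (A `&` ~` P).
have rd : realmeas d by apply: realmeasD; exact: realmeas_restr.
have dE A : measurable A -> d A = hu A - s A.
  move=> mA; have ua B : measurable B -> hu B = h1 B + a B.
    by move=> mB; apply: EFin_inj; rewrite -Eu // H1 // E1 // Ea.
  have ub B : measurable B -> hu B = h2 B + b B.
    by move=> mB; apply: EFin_inj; rewrite -Eu // H2 // E2 // Eb.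
  rewrite sE // (realmeasU ru mA mP) ua; last exact: measurableI.
  by rewrite ub /d; [lra|exact: measurableI].
have [_ Ss Is] := cs.
exists (fun A => (d A)%:E); split; last first.
  by move=> A mA; rewrite Eu // dE // -EFinD; congr (_%:E); lra.
apply: (conefun_in_cone (h := d) K0) => //.
split => //; first by rewrite dE ?Su ?Ss ?subrr //; exact: measurableC.
by move=> g A mA; rewrite !dE ?Iu ?Is //; exact: mF.
Qed.

End simplex.

(** * Approximation by empirical means *)

Lemma size_flatten_nseq (J : finType) (k : J -> nat) :
  size (flatten [seq nseq (k v) v | v <- enum J]) = (\sum_v k v)%N.
Proof.
rewrite size_flatten /shape -map_comp sumnE big_map big_enum /=.
by apply: eq_bigr => v _; rewrite size_nseq.
Qed.

Lemma sum_flatten_nseq (R : realType) (J : finType) (k : J -> nat) (g : J -> R) :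
  \sum_(v <- flatten [seq nseq (k v) v | v <- enum J]) g v =
  \sum_v (k v)%:R * g v.
Proof.
rewrite big_flatten big_map big_enum /=; apply: eq_bigr => v _.
by rewrite big_nseq iter_addr_0 mulr_natl.
Qed.

(** Repeat each [v] about [M * w v] times, rounded down. Rounding costs at most one per element of
    [J], so both the sum and the length of the list are off by a bounded amount, negligible after
    division by the length. *)
Lemma rational_weights (R : realType) (J : finType) (w : J -> R) (B eps : R) :
  (forall v, 0 <= w v) -> \sum_v w v = 1 -> 0 <= B -> 0 < eps ->
  exists s : seq J, [/\ (0 < size s)%N, forall v, v \in s -> 0 < w v &
    forall g : J -> R, (forall v, `|g v| <= B) ->
      `|(size s)%:R^-1 * (\sum_(v <- s) g v) - \sum_v w v * g v| < eps].
Proof.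
move=> w0 w1 B0 e0.
pose C : R := #|J|%:R.
(* The length of the list is at least [M - C], and the total error is at most [2 * C * B]; this [M]
   makes the length exceed [2 * C * B / eps]. *)
pose M := (Num.trunc (2 * C * B / eps + C + 1)).+1.
have hM : 2 * C * B / eps + C + 1 < M%:R.
  by rewrite /M; apply: Num.Theory.truncnS_gt.
pose k v := Num.trunc (M%:R * w v).
have k1 v : (k v)%:R <= M%:R * w v.
  by rewrite Num.Theory.truncn_le mulr_ge0.
have k2 v : M%:R * w v - 1 <= (k v)%:R.
  by rewrite lerBlDr natr1 ltW // Num.Theory.truncnS_gt.
pose s := flatten [seq nseq (k v) v | v <- enum J].
have sE : (size s)%:R = \sum_v (k v)%:R :> R by rewrite size_flatten_nseq natr_sum.
have MW : M%:R = \sum_v M%:R * w v by rewrite -mulr_sumr w1 mulr1.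
have s1 : (size s)%:R <= M%:R :> R.
  by rewrite sE MW; apply: ler_sum => v _; exact: k1.
have s2 : M%:R - C <= (size s)%:R :> R.
  rewrite sE MW (_ : C = \sum_(v : J) 1); last by rewrite sumr_const.
  by rewrite -sumrB; apply: ler_sum.
have C0 : 0 <= C by [].
have e1 : 0 <= 2 * C * B / eps by apply: divr_ge0; [apply: mulr_ge0 => //;
  apply: mulr_ge0|exact: ltW].
have s0 : 0 < (size s)%:R :> R by lra.
exists s; split; first by rewrite ltr0n in s0.
  move=> v /flatten_mapP [u _]; rewrite mem_nseq => /andP[ku /eqP ->].
  rewrite lt_neqAle w0 andbT; apply: contraTneq ku => wu.
  by rewrite /k -wu mulr0 Num.Theory.truncn0.
move=> g gB.
have W : `|\sum_v w v * g v| <= B.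
  apply: le_trans (ler_norm_sum _ _ _) _.
  rewrite -[leRHS]mul1r -w1 mulr_suml; apply: ler_sum => v _.
  by rewrite normrM ger0_norm // ler_wpM2l.
rewrite sum_flatten_nseq -/s.
set A := \sum_v (k v)%:R * g v; set W0 := \sum_v w v * g v in W *.
have AM : `|A - M%:R * W0| <= C * B.
  rewrite /A /W0 mulr_sumr -sumrB; apply: le_trans (ler_norm_sum _ _ _) _.
  rewrite /C -sum1_card natr_sum mulr_suml; apply: ler_sum => v _.
  rewrite mulrA -mulrBl normrM ler_pM // ler_norml.
  by move: (k1 v) (k2 v); lra.
have E : A - (size s)%:R * W0 = (A - M%:R * W0) + (M%:R - (size s)%:R) * W0 by ring.
have D : `|A - (size s)%:R * W0| <= 2 * C * B.
  rewrite E; apply: le_trans (ler_normD _ _) _.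
  suff : `|(M%:R - (size s)%:R) * W0| <= C * B by lra.
  by rewrite normrM ler_pM // ger0_norm; lra.
have -> : (size s)%:R^-1 * A - W0 = (size s)%:R^-1 * (A - (size s)%:R * W0).
  by rewrite mulrBr mulKf // gt_eqF.
rewrite normrM gtr0_norm ?invr_gt0 // mulrC ltr_pdivrMr //.
apply: le_lt_trans D _; rewrite -ltr_pdivrMl // mulrC; lra.
Qed.

Lemma sum_mul_blocks (R : realType) (a : nat -> R) (M N : nat) :
  \sum_(t < M * N) a t = \sum_(k < M) \sum_(j < N) a (k * N + j)%N.
Proof.
elim: M => [|M IH]; first by rewrite !big_ord0.
rewrite big_ord_recr /= -IH mulSn addnC big_split_ord /=.
by congr (_ + _); apply: eq_bigr => j _; rewrite /= ?addnC.
Qed.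

Lemma sum_boundary (R : realType) (m N : nat) :
  \sum_(j < N) ((j < m) || (N <= j + m))%N%:R <= (m + m)%:R :> R.
Proof.
rewrite -natr_sum ler_nat.
have H : (\sum_(j < N) (j < m) <= m)%N.
  elim: N => [|N IH]; first by rewrite big_ord0.
  rewrite big_ord_recr /=; case: (ltnP N m) => Nm; last by rewrite addn0.
  rewrite addn1 (leq_ltn_trans _ Nm) //.
  have := @leq_sum 'I_N (index_enum _) xpredT (fun j => (j < m)%N : nat) (fun=> 1%N).
  by rewrite sum_nat_const card_ord muln1; apply => j _; case: (_ < _)%N.
have H' : (\sum_(j < N) (N <= j + m) <= m)%N.
  rewrite (reindex_inj rev_ord_inj) /=; apply: leq_trans H; apply: leq_sum => j _.
  have := ltn_ord j; case: (leqP N (N - j.+1 + m)%N) => //= Hj jN.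
  by rewrite (_ : (j < m)%N = true) //; lia.
apply: leq_trans (leq_add H H'); rewrite -big_split /=; apply: leq_sum => j _.
by case: (j < m)%N; case: (N <= _)%N.
Qed.

Section expect.
Variables (R : realType) (X : ptopologicalType) (c : nat -> X -> bool).
Hypothesis cX : cantor_coords c.
Local Notation T := (Borel X).
Local Notation prob := (probability T R).
Implicit Types (mu : prob) (f g : X -> R).

Definition expect mu f : R := fine (\int[mu]_x ((f : T -> R) x)%:E).

Lemma expectE mu f : continuous f ->
  (\int[mu]_x ((f : T -> R) x)%:E = (expect mu f)%:E)%E.
Proof.
move=> cf; rewrite /expect fineK //; apply: integrable_fin_num => //.
exact: (continuous_integrable cX).
Qed.

Lemma level_continuous f m : (forall x y, agree c m x y -> f x = f y) ->
  continuous f.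
Proof.
move=> H; apply/(cantor_continuousP cX) => x U Ux; exists m => y /H <-.
exact: nbhs_singleton.
Qed.

Lemma expectD mu f g : continuous f -> continuous g ->
  expect mu (fun x => f x + g x) = expect mu f + expect mu g.
Proof.
move=> cf cg; apply: EFin_inj; rewrite EFinD -!expectE //; last first.
  by move=> x; apply: cvgD; [exact: cf|exact: cg].
under eq_integral do rewrite EFinD.
by rewrite integralD //; exact: (continuous_integrable cX).
Qed.

Lemma expectZ mu (a : R) f : continuous f ->
  expect mu (fun x => a * f x) = a * expect mu f.
Proof.
move=> cf; apply: EFin_inj; rewrite EFinM -!expectE //; last first.
  by move=> x; apply: cvgM; [exact: cvg_cst|exact: cf].
under eq_integral do rewrite EFinM.
by rewrite integralZl //; exact: (continuous_integrable cX).
Qed.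

Lemma expect_cst mu (a : R) : expect mu (fun=> a) = a.
Proof.
rewrite /expect integral_cst //.
by rewrite [X in (_ * X)%E](_ : _ = 1%E) ?mule1 //; exact: probability_setT.
Qed.

Lemma continuous_sum (I : Type) (s : seq I) (f : I -> X -> R) :
  (forall i, continuous (f i)) -> continuous (fun x => \sum_(i <- s) f i x).
Proof.
move=> cf; elim: s => [|i s IH] x.
  by under eq_fun do rewrite big_nil; exact: cvg_cst.
have -> : (fun x => \sum_(j <- i :: s) f j x) = (fun x
  => f i x + \sum_(j <- s) f j x).
  by apply/funext => y; rewrite big_cons.
by apply: cvgD; [exact: cf|exact: IH].
Qed.

Lemma expect_sum mu (I : Type) (s : seq I) (f : I -> X -> R) :
  (forall i, continuous (f i)) ->
  expect mu (fun x => \sum_(i <- s) f i x) = \sum_(i <- s) expect mu (f i).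
Proof.
move=> cf; elim: s => [|i s IH].
  by rewrite big_nil; under eq_fun do rewrite big_nil; rewrite expect_cst.
rewrite big_cons -IH -expectD //; last exact: continuous_sum.
by congr expect; apply/funext => x; rewrite big_cons.
Qed.

Lemma expect_indic mu (A : set X) : measurable (A : set T) ->
  expect mu (\1_A) = fine (mu A).
Proof. by move=> mA; rewrite /expect integral_indic // setIT. Qed.

Lemma expect_bound mu f (e : R) : continuous f -> (forall x, `|f x| <= e) ->
  `|expect mu f| <= e.
Proof.
move=> cf fe; rewrite -lee_fin -abse_EFin -expectE //.
have mf : measurable_fun setT (f : T -> R) by exact: continuous_measurable_real.
apply: le_trans (le_abse_integral _ _ _) _ => //; first exact/measurable_EFinP.
apply: le_trans (integral_le_bound e%:E _ _ _ _) _ => //.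
- exact/measurable_EFinP.
- by apply: le_trans (fe point).
- by apply/aeW => x _; rewrite lee_fin.
- by rewrite [X in (_ * X)%E](_ : _ = 1%E) ?mule1 //; exact: probability_setT.
Qed.

(** Replace each [f i] by the step function taking, on every cylinder of a fine level [m], its value
    at a chosen representative. Its integral is a finite weighted sum, and the weights are then made
    rational by repetition. *)
Lemma empirical_approx mu (S : set X) (q : nat) (f : 'I_q -> X -> R) (eps : R) :
  closed S -> mu S = 1%E -> (forall i, continuous (f i)) -> 0 < eps ->
  exists M (x : nat -> X), [/\ (0 < M)%N, forall k, (k < M)%N -> S (x k) &
    forall i, `|M%:R^-1 * (\sum_(k < M) f i (x k)) - expect mu (f i)| < eps].
Proof.
move=> cS muS cf e0.
have e2 : 0 < eps / 2 by rewrite divr_gt0.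
have [m Hm] := cantor_unif_continuous cX cf e2.
have [B B0 fB] := cantor_bounded_family cX cf.
pose J := {ffun 'I_m -> bool}.
pose code (x : X) : J := [ffun k : 'I_m => c k x].
pose cell (v : J) : set X := [set x | code x = v].
have codeE x y : code x = code y <-> agree c m x y.
  split=> [E k km|E]; last by apply/ffunP => k; rewrite !ffunE E.
  by have /ffunP /(_ (Ordinal km)) := E; rewrite !ffunE.
have fcell v : finlevel c (cell v).
  by exists m => x y /codeE; rewrite /cell /= => ->.
have mcell v : measurable (cell v : set T) by exact: (finlevel_measurable cX).
pose w v := fine (mu (cell v)).
have ccell v : continuous (\1_(cell v) : X -> R) by exact: (finlevel_continuous cX).
have sum_cell (g : J -> R) x : \sum_v g v * \1_(cell v) x = g (code x).
  rewrite (bigD1 (code x)) //= big1 ?addr0.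
    by rewrite indicE mem_set // mulr1.
  by move=> v /eqP vx; rewrite indicE memNset ?mulr0 // => /esym.
have cont_step (g : J -> R) : continuous (fun x => g (code x)).
  by apply: (@level_continuous _ m) => x y /codeE ->.
have exp_step (g : J -> R) : expect mu (fun x => g (code x)) = \sum_v w v * g v.
  transitivity (expect mu (fun x => \sum_v g v * \1_(cell v) x)).
    by congr expect; apply/funext => x; rewrite sum_cell.
  rewrite expect_sum; last first.
    by move=> v x; apply: cvgM; [exact: cvg_cst|exact: ccell].
  by apply: eq_bigr => v _; rewrite expectZ // expect_indic // mulrC.
have w0 v : 0 <= w v by exact: fine_ge0.
have w1 : \sum_v w v = 1.
  by rewrite -(expect_cst mu 1) (exp_step (fun=> 1)); apply: eq_bigr => v _;
    rewrite mulr1.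
(* The representative lies in its cell when the cell is nonempty, which controls the error, and in
   [S] when the cell has positive mass. The list [s] uses only cells of positive mass, so all sample
   points lie in [S]. *)
have pick v : exists y, (cell v !=set0 -> cell v y) /\ (0 < w v -> S y).
  have [wv|wv] := ltP 0 (w v).
    have [y [cy Sy]] : (cell v `&` S) !=set0.
      apply/set0P/eqP => E; move: wv; rewrite /w.
      have -> : fine (mu (cell v)) = 0; last by rewrite ltxx.
      apply/eqP; rewrite eq_le fine_ge0 // andbT.
      move/(prob_setC0 cS): muS => muS.
      have -> : 0 = fine (mu (~` S)) by rewrite muS.
      apply: (realmeas_le (realmeas_prob mu)) => //.
        by apply: measurableC; exact: closed_borel.
      by move=> y cy Sy; have : (cell v `&` S) y by []; rewrite E.
    by exists y.
  have [[y cy]|ne] := pselect (cell v !=set0); first by exists y.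
  by exists point.
have [pt Hpt] := choice pick.
have [s [s0 sw Hs]] := rational_weights w0 w1 B0 e2.
exists (size s), (fun k => pt (nth [ffun=> false] s k)); split => //.
  by move=> k ks; apply: (proj2 (Hpt _)); apply/sw/mem_nth.
move=> i; have := Hs (fun v => f i (pt v)) (fun v => fB i _).
rewrite -exp_step (big_nth [ffun=> false]) big_mkord.
set a := _ * _; set b := expect _ _ => Hab.
have Hb : `|b - expect mu (f i)| <= eps / 2.
  have -> : b - expect mu (f i) = expect mu (fun x => f i (pt (code x)) + -1 * f i x).
    rewrite expectD //; last by move=> x; apply: cvgM; [exact: cvg_cst|exact: cf].
      by rewrite expectZ // mulN1r.
    exact: (cont_step (fun v => f i (pt v))).
  apply: expect_bound => [|x].
    move=> x; apply: cvgD; first exact: (cont_step (fun v => f i (pt v))).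
    by apply: cvgM; [exact: cvg_cst|exact: cf].
  rewrite mulN1r ltW // Hm //; apply/codeE.
  by have [+ _] := Hpt (code x); apply; exists x.
have -> : a - expect mu (f i) = (a - b) + (b - expect mu (f i)) by ring.
by apply: le_lt_trans (ler_normD _ _) _; lra.
Qed.

End expect.

(** * Orbit measures are extreme and dense *)

(** Advancing the starting point by one step moves the first term to the end of the sum. *)
Lemma sum_periodic_shift (R : realType) (X : Type) (tau : X -> X) (P : nat)
    (x : X) (phi : X -> R) (j : nat) : iter P tau x = x ->
  \sum_(i < P) phi (iter i tau (iter j tau x)) = \sum_(i < P) phi (iter i tau x).
Proof.
move=> px; elim: j => [|j IH] //; rewrite -IH; set y := iter j tau x.
have py : iter P tau y = y by rewrite /y -iterD addnC iterD px.
case: P px py {IH} => [|P] _ py; first by rewrite !big_ord0.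
rewrite [RHS]big_ord_recl big_ord_recr /= addrC -iterSr -iterS py.
by congr (_ + _); apply: eq_bigr => i _; rewrite -iterSr.
Qed.

Section orbit.
Variables (R : realType) (X : ptopologicalType) (c : nat -> X -> bool).
Hypothesis cX : cantor_coords c.
Local Notation T := (Borel X).
Local Notation prob := (probability T R).

Lemma integral_image (Y : ptopologicalType) (cc : nat -> Y -> bool)
    (j : X -> Y) (nu : prob) (mu : probability (Borel Y) R) (f : Y -> R) :
  cantor_coords cc -> continuous j ->
  (forall B : set (Borel Y), measurable B -> nu ((j : T ->
    Borel Y) @^-1` B) = mu B) ->
  continuous f ->
  (\int[mu]_y ((f : Borel Y -> R) y)%:E = \int[nu]_x ((f \o j : T -> R) x)%:E)%E.
Proof.
move=> cY cj numu cf.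
have mj : measurable_fun setT (j : T -> Borel Y) by exact: continuous_borel.
rewrite -(@integral_pushforward _ _ T (Borel Y) R j mj nu setT (fun y =>
  (f y)%:E)) //.
- by apply: eq_measure_integral => A mA _; exact: esym (numu A mA).
- by apply/measurable_EFinP; exact: continuous_measurable_real.
- apply: (continuous_integrable cX) => x; apply: continuous_comp;
  [exact: cj|exact: cf].
Qed.

Variables (tau : X -> X) (P : nat) (x : X).

(** Uniform measure over [P] consecutive orbit points. The normalization makes it a probability for
    every [P], the Dirac mass being the value at [P = 0]. *)
Definition orbit_prob : prob :=
  mnormalize (msum (fun i => @dirac _ T (iter i tau x : T) R) P) (@dirac _ T
    (x : T) R).

Hypothesis P0 : (0 < P)%N.

Lemma orbit_probE (A : set T) : measurable A ->
  orbit_prob A = (P%:R^-1 * \sum_(i < P) \1_A (iter i tau x))%:E.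
Proof.
move=> mA.
pose ms : {measure set T -> \bar R} :=
  msum (fun i => @dirac _ T (iter i tau x : T) R) P.
have E B : measurable B -> ms B =
    (\sum_(i < P) \1_B (iter i tau x))%:E.
  by move=> mB; rewrite /ms /= /msum -sumEFin; apply: eq_bigr.
transitivity (mnormalize ms (@dirac _ T (x : T) R) A); first by [].
rewrite /mnormalize !E //.
have -> : \sum_(i < P) (\1_setT (iter i tau x) : R) = P%:R.
  rewrite -[RHS]mulr_natl -[in RHS](card_ord P) -[RHS]/(_ * 1) mulr_natl -sumr_const.
  by apply: eq_bigr => i _; rewrite indicT.
by rewrite eqe pnatr_eq0 eqn0Ngt P0 /= E // -EFinM mulrC.
Qed.

Lemma expect_orbit (f : X -> R) : continuous f ->
  expect orbit_prob f = P%:R^-1 * \sum_(i < P) f (iter i tau x).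
Proof.
move=> cf.
have P1 : 0 < P%:R^-1 :> R by rewrite invr_gt0 ltr0n.
(* Adding the bound [B] makes the integrand nonnegative, so that the integral against a sum of Dirac
   masses splits. *)
have [B B0 fB] := cantor_bounded cX cf.
pose g y := f y + B.
have g0 y : 0 <= g y by rewrite -lerBlDr sub0r; have := fB y;
  rewrite ler_norml => /andP[].
have cg : continuous g by move=> y; apply: cvgD; [exact: cf|exact: cvg_cst].
have mg : measurable_fun setT ((fun y => (g y)%:E) : T -> \bar R).
  by apply/measurable_EFinP; exact: continuous_measurable_real.
have -> : f = (fun y => g y + - B) by apply/funext => y; rewrite /g addrK.
rewrite (expectD cX) //; last by move=> y; exact: cvg_cst.
rewrite (expect_cst) // big_split /= mulrDr.
have -> : \sum_(i < P) (- B) = P%:R * (- B) by rewrite sumr_const card_ord mulr_natl.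
rewrite mulKf ?pnatr_eq0 -?lt0n //; congr (_ + _).
apply: EFin_inj; rewrite -(expectE cX) //.
pose m := mscale (NngNum (ltW P1)) (msum (fun i => @dirac _ T
  (iter i tau x : T) R) P).
transitivity (\int[m]_y ((g : T -> R) y)%:E)%E.
  apply: eq_measure_integral => A mA _; rewrite [LHS]orbit_probE // EFinM -sumEFin.
  by [].
rewrite ge0_integral_mscale //; last by move=> y _; rewrite lee_fin.
rewrite ge0_integral_measure_sum //; last by move=> y _; rewrite lee_fin.
rewrite EFinM -sumEFin; congr (_ * _)%E; apply: eq_bigr => i _.
by rewrite integral_dirac // diracT mul1e.
Qed.

Hypothesis per : iter P tau x = x.

Lemma orbit_prob_inv : continuous tau -> invariant_under tau orbit_prob.
Proof.
move=> ct B mB; rewrite !orbit_probE //; last first.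
  exact: (measurable_preimage ct).
congr (_ * _)%:E; rewrite -[RHS](sum_periodic_shift _ 1 per).
by apply: eq_bigr => i _ /=; rewrite -iterSr.
Qed.

Lemma orbit_prob_supp (S : set T) : measurable S ->
  (forall i, S (iter i tau x)) -> orbit_prob S = 1%E.
Proof.
move=> mS HS; rewrite orbit_probE //.
rewrite (eq_bigr (fun=> 1)); last by move=> i _; rewrite indicE mem_set.
by rewrite sumr_const card_ord mulVf // pnatr_eq0 -lt0n.
Qed.

Lemma invariant_iter (m : prob) i : continuous tau -> invariant_under tau m ->
  forall A : set T, measurable A ->
  measurable ((iter i tau : T -> T) @^-1` A) /\ m ((iter i tau : T ->
    T) @^-1` A) = m A.
Proof.
move=> ct im A mA; elim: i => [|i [mi ei]] //.
have -> : (iter i.+1 tau : T -> T) @^-1` A = (tau : T ->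
  T) @^-1` (iter i tau @^-1` A).
  by apply/seteqP; split => y /=; rewrite -iterS iterSr.
split; last by rewrite im.
exact: (measurable_preimage ct).
Qed.

Lemma continuous_iter i : continuous tau -> continuous (iter i tau).
Proof.
move=> ct; elim: i => [|i IH] y; first exact: cvg_id.
by apply: (@continuous_comp _ _ _ (iter i tau) tau); [exact: IH|exact: ct].
Qed.

(* On the orbit the Birkhoff average of [\1_A] over one period is the constant
   [orbit_prob A], and it integrates to [m A] for every invariant [m]. *)
Lemma inv_prob_orbit (m : prob) : continuous tau -> invariant_under tau m ->
  (forall D : set T, measurable D -> orbit_prob D = 1%E -> m D = 1%E) ->
  forall A : set T, measurable A -> m A = orbit_prob A.
Proof.
move=> ct im ac; apply: (measure_eq_finlevel cX).
  by rewrite -ge0_fin_numE // fin_num_measure.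
move=> A fA; have mA : measurable (A : set T) by exact: (finlevel_measurable cX).
have cA : continuous (\1_A : X -> R) by exact: (finlevel_continuous cX).
pose g y : R := P%:R^-1 * \sum_(i < P) \1_A (iter i tau y).
have cAi i : continuous (fun y => \1_A (iter i tau y) : R).
  move=> y; apply: (@continuous_comp _ _ _ (iter i tau) (\1_A : X -> R)).
    exact: continuous_iter.
  exact: cA.
have cs : continuous (fun y => \sum_(i < P) \1_A (iter i tau y) : R).
  exact: continuous_sum.
have cg : continuous g by move=> y; apply: cvgM; [exact: cvg_cst|exact: cs].
have mg : measurable_fun setT (g : T -> R) by exact: continuous_measurable_real.
pose D : set T := g @^-1` [set g x].
have mD : measurable D by rewrite -[X in measurable X]setTI; apply: mg.
have m1 : m D = 1%E.
  apply: ac => //; apply: orbit_prob_supp => // j.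
  by rewrite /D /preimage /= /g sum_periodic_shift.
have E1 : expect m g = g x.
  rewrite -[RHS](expect_cst m) /expect; congr fine.
  apply: ae_eq_integral => //; first exact/measurable_EFinP.
  exists (~` D); split; first exact: measurableC.
    transitivity (1 - m D)%E; first exact: probability_setC.
    by rewrite m1 subee.
  by move=> y /= ny Dy; apply: ny => _; rewrite Dy.
have E2 : expect m g = fine (m A).
  rewrite (expectZ cX) // (expect_sum cX) //.
  rewrite (eq_bigr (fun=> fine (m A))).
    rewrite sumr_const card_ord -[X in _ * X]mulr_natl mulKf // pnatr_eq0 -lt0n //.
  move=> i _; have [mi ei] := invariant_iter i ct im mA.
  by rewrite -ei -expect_indic.
transitivity (fine (m A))%:E; first exact: prob_fine.
by rewrite -E2 E1; apply/esym; exact: orbit_probE.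
Qed.

(** In a proper convex decomposition, a set of full orbit measure has full measure for both
    components, so each invariant component is the orbit measure itself. *)
Lemma orbit_prob_extreme (K : set prob) : continuous tau ->
  (forall m, K m -> invariant_under tau m) -> K orbit_prob ->
  is_extreme K orbit_prob.
Proof.
move=> ct KI Kx; split => // m1 m2 t K1 K2 /andP[t0 t1] H A mA.
suff E m : K m -> (forall D : set T, measurable D -> orbit_prob D = 1%E ->
    m D = 1%E) -> m A = orbit_prob A.
  have H' D : measurable D -> orbit_prob D = 1%E ->
      t * fine (m1 D) + (1 - t) * fine (m2 D) = 1.
    move=> mD; rewrite H // (prob_fine m1) // (prob_fine m2) //.
    by rewrite -!EFinM -EFinD => -[].
  have le1 (m : prob) D : measurable D -> fine (m D) <= 1.
    by move=> mD; rewrite -lee_fin -prob_fine // probability_le1.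
  rewrite !E //.
  - move=> D mD /(H' _ mD) HD; rewrite (prob_fine m2) //; congr (_%:E).
    have := le1 m1 _ mD; have := le1 m2 _ mD; nra.
  - move=> D mD /(H' _ mD) HD; rewrite (prob_fine m1) //; congr (_%:E).
    have := le1 m1 _ mD; have := le1 m2 _ mD; nra.
by move=> Km ac; apply: inv_prob_orbit => //; exact: KI.
Qed.

End orbit.

(** * Density of the extreme points from a gluing property *)

Section density.
Variables (R : realType) (X : ptopologicalType) (c : nat -> X -> bool).
Hypothesis cX : cantor_coords c.
Variables (S : set X) (tau : X -> X).
Hypotheses (cS : closed S) (ct : continuous tau)
  (tS : forall x, S x -> S (tau x)).

(* [H'] looks like [H k] on the [k]-th of [M] consecutive blocks of length [N],
   except within distance [m'] of the ends of the block. *)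
Hypothesis glue : forall m, exists m', forall (N M : nat) (H : nat -> X),
  (0 < N)%N -> (0 < M)%N -> (forall k, (k < M)%N -> S (H k)) ->
  exists H', [/\ S H', iter (M * N) tau H' = H' &
    forall k i, (k < M)%N -> (m' <= i)%N -> (i + m' < N)%N ->
      agree c m (iter (k * N + i) tau H') (iter i tau (H k))].

Let K : set (probability (Borel X) R) := inv_on S (fun _ : unit => tau).

Lemma inv_on_extreme_dense : weak_dense (is_extreme K) K.
Proof.
move=> mu Kmu q f cf eps e0; have [muS Imu] := Kmu.
have e4 : 0 < eps / 4 by rewrite divr_gt0.
have [m Hm] := cantor_unif_continuous cX cf e4.
have [m' Hm'] := glue m.
have [B B0 fB] := cantor_bounded_family cX cf.
(* So long that the [m' + m'] positions near the ends of a block, each with error at most [2 * B],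
   contribute less than [eps / 4] on average. *)
pose N := (Num.trunc (2 * B * (m' + m')%:R / (eps / 4))).+1.
have N0 : 0 < N%:R :> R by rewrite ltr0n.
have hN : 2 * B * (m' + m')%:R < N%:R * (eps / 4).
  by rewrite -ltr_pdivrMr // truncnS_gt.
(* By invariance the Birkhoff average over the window has the same [mu]-integral as [f i]; it is the
   averages that are approximated by empirical means. *)
pose F i (x : X) : R := N%:R^-1 * \sum_(j < N) f i (iter j tau x).
have cfj i j : continuous (fun x => f i (iter j tau x)).
  move=> x; apply: (@continuous_comp _ _ _ (iter j tau) (f i)); last exact: cf.
  exact: continuous_iter.
have csum i : continuous (fun x => \sum_(j < N) f i (iter j tau x)).
  exact: (@continuous_sum R X _ _ (fun (j : 'I_N) x => f i (iter j tau x))).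
have cF i : continuous (F i).
  by move=> x; apply: cvgM; [exact: cvg_cst|exact: csum].
have EF i : expect mu (F i) = expect mu (f i).
  rewrite (expectZ cX); last exact: csum.
  rewrite (expect_sum cX) // (eq_bigr (fun=> expect mu (f i))).
    by rewrite sumr_const card_ord -[X in _ * X]mulr_natl mulKf // gt_eqF.
  move=> j _; rewrite /expect; congr fine; apply/esym.
  apply: (integral_image cX cX) => //; first exact: continuous_iter.
  by move=> A mA; case: (invariant_iter j ct (Imu tt) mA).
have [M [H [M0 HS HM]]] := empirical_approx cX cS muS cF e4.
have [H' [SH' pH' aH']] := Hm' N M H isT M0 HS.
have MN0 : (0 < M * N)%N by rewrite muln_gt0 M0.
have SH i : S (iter i tau H') by elim: i => //= i; exact: tS.
pose nu : probability (Borel X) R := orbit_prob R tau (M * N) H'.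
have Knu : K nu.
  split; first by apply: orbit_prob_supp => //; exact: closed_borel.
  by move=> _; exact: orbit_prob_inv.
exists nu; split.
  by apply: (orbit_prob_extreme cX) => // m1 [_ /(_ tt)].
move=> i; rewrite !(expectE cX) // -EFinB abse_EFin lte_fin -EF.
(* The three errors of [eps / 4] come from uniform continuity inside the blocks, from the block
   ends, and from the empirical approximation. *)
rewrite (expect_orbit cX) //;
  apply: le_lt_trans (_ : _ <= eps / 4 + eps / 4 + eps / 4) _; last by lra.
pose a := M%:R^-1 * (\sum_(k < M) F i (H k)).
rewrite (_ : _ - _ = (((M * N)%:R^-1 * \sum_(t < M * N) f i (iter t tau H')) - a)
   + (a - expect mu (F i))); last by ring.
apply: le_trans (ler_normD _ _) _; apply: lerD; last by rewrite ltW // HM.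
have M0' : 0 < M%:R :> R by rewrite ltr0n.
rewrite (sum_mul_blocks (fun t => f i
  (iter t tau H'))) /a natrM invfM -mulrA -mulrBr mulr_sumr -sumrB.
rewrite normrM gtr0_norm ?invr_gt0 // ler_pdivrMl //.
apply: le_trans (ler_norm_sum _ _ _) _.
rewrite -[X in X%:R * _](card_ord M) mulr_natl -sumr_const; apply: ler_sum => k _.
rewrite /F -mulrBr normrM gtr0_norm ?invr_gt0 // ler_pdivrMl // -sumrB.
apply: le_trans (ler_norm_sum _ _ _) _.
(* Positions near a block end are charged the trivial bound [2 * B]; at all others gluing and
   uniform continuity give [eps / 4]. *)
apply: le_trans (_ : _ <= \sum_(j < N) (eps / 4 +
   2 * B * ((j < m') || (N <= j + m'))%N%:R)) _.
  apply: ler_sum => j _; case: (boolP ((j < m') || (N <= j + m'))%N) => [_|] /=.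
    rewrite mulr1; apply: le_trans (ler_normB _ _) _.
    by have := fB i (iter (k * N + j) tau H'); have := fB i (iter j tau (H k)); lra.
  rewrite negb_or -leqNgt -ltnNge => /andP[j1 j2].
  by rewrite mulr0 addr0 ltW // Hm //; exact: aH'.
have -> : \sum_(j < N) (eps / 4 + 2 * B * ((j < m') || (N <= j + m'))%N%:R) =
    N%:R * (eps / 4) + 2 * B * \sum_(j < N) ((j < m') || (N <= j + m'))%N%:R.
  by rewrite big_split /= mulr_sumr sumr_const card_ord (mulr_natl (eps / 4)).
rewrite mulrDr lerD2l.
apply: le_trans (ltW hN); rewrite ler_wpM2l ?mulr_ge0 //; exact: sum_boundary.
Qed.

Lemma inv_on_poulsen : poulsen_simplex K.
Proof. by split;
  [exact: (@inv_on_simplex R X c cX S unit (fun=> tau) cS (fun _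
    => ct))|exact: inv_on_extreme_dense]. Qed.

End density.

(** * Subgroups of A *)

Lemma countable_enum (I : Type) (i0 : I) (C : countType) (f : I -> C) :
  injective f -> exists e : nat -> I, forall i, exists k, e k = i.
Proof.
move=> fi.
have H k : exists i, (exists i', pickle (f i') = k) -> pickle (f i) = k.
  have [[i Hi]|no] := pselect (exists i', pickle (f i') = k); first by exists i.
  by exists i0.
have [e He] := choice H; exists e => i; exists (pickle (f i)).
by apply/fi/(pcan_inj pickleK)/He; exists i.
Qed.

Section Anp_theory.
Variables n p : nat.
Local Notation A := (Anp n p).
Implicit Types x y w : A.

Lemma Anp_ext x y : sval x =1 sval y -> x = y.
Proof.
case: x y => [x Hx] [y Hy] /= /funext xy; subst y.
by congr exist; exact: Prop_irrelevance.
Qed.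

Definition Anp_bound x : nat := sval (cid (svalP x)).

Lemma Anp_boundP x (i : int) : (Anp_bound x < `|i|)%N -> sval x i = 0.
Proof. by rewrite /Anp_bound; case: cid => N /= H /H. Qed.

Definition Anp_code x : nat * seq 'rV['F_p]_n :=
  (Anp_bound x, mkseq (fun j => sval x (j%:Z - (Anp_bound x)%:Z))
    (Anp_bound x).*2.+1).

Lemma Anp_code_inj : injective Anp_code.
Proof.
move=> x y E; have bE : Anp_bound x = Anp_bound y := congr1 fst E.
have sE := congr1 snd E; apply: Anp_ext => i.
have [ib|ib] := ltnP (Anp_bound x) `|i|.
  by rewrite !Anp_boundP // -bE.
have := congr1 (fun s => nth 0 s (absz (i + (Anp_bound x)%:Z))) sE.
rewrite !nth_mkseq -?bE; do ?lia.
by have -> : (absz (i + Anp_bound x))%:Z - (Anp_bound x)%:Z = i by lia.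
Qed.

Lemma Anp_enum : exists e : nat -> A, forall x, exists k, e k = x.
Proof. exact: (countable_enum (Azero n p) Anp_code_inj). Qed.

Lemma Lnp_enum : exists e : nat -> Lnp n p, forall g, exists k, e k = g.
Proof.
apply: (@countable_enum _ (Lone n p) _ (fun g : Lnp n p => (Anp_code g.1, g.2))).
move=> [x k] [y l] E; have /= -> := congr1 snd E.
by rewrite (Anp_code_inj (congr1 fst E : Anp_code x = Anp_code y)).
Qed.

Lemma Anp_shift0 x : shift 0 x = x.
Proof. by apply: Anp_ext => i /=; rewrite addr0. Qed.

Lemma Anp_shiftD (k l : int) x : shift k (shift l x) = shift (k + l) x.
Proof. by apply: Anp_ext => i /=; rewrite addrA. Qed.

Lemma shift_zero (k : int) : shift k (Azero n p) = Azero n p.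
Proof. exact: Anp_ext. Qed.

Lemma shift_add (k : int) x y : shift k (Aadd x y) = Aadd (shift k x) (shift k y).
Proof. exact: Anp_ext. Qed.

Lemma shift_opp (k : int) x : shift k (Aopp x) = Aopp (shift k x).
Proof. exact: Anp_ext. Qed.

Lemma block_fin (N : nat) (k : int) x : exists M : nat, forall i : int,
  (M < `|i|)%N ->
  (fun j => if (0 <= j < N%:Z) then sval x (j + k * N%:Z) else 0) i = 0.
Proof. by exists N => i /= Ni; case: ifP => //; lia. Qed.

Definition block N k x : A := exist _ _ (block_fin N k x).

Lemma block_zero N k : block N k (Azero n p) = Azero n p.
Proof. by apply: Anp_ext => i /=; case: ifP. Qed.

Lemma block_add N k x y : block N k (Aadd x y) = Aadd (block N k x) (block N k y).
Proof. by apply: Anp_ext => i /=; case: ifP; rewrite ?addr0. Qed.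

Lemma block_opp N k x : block N k (Aopp x) = Aopp (block N k x).
Proof. by apply: Anp_ext => i /=; case: ifP; rewrite ?oppr0. Qed.

Lemma block_shift N (k l : int) x :
  block N k (shift (- (l * N%:Z)) x) = block N (k - l) x.
Proof. by apply: Anp_ext => j /=; case: ifP => // _; congr (sval x _); ring. Qed.

(** The direct sum over [k] of the translates by [k * N] of the elements of [H (k mod M)] supported
    in [0, N), encoded as a test on every block of [w]. *)
Definition glued (N M : nat) (H : nat -> A -> bool) : A -> bool :=
  fun w => `[< forall k : int, H (absz (modz k M%:Z)) (block N k w) >].

Lemma absz_modz_lt (k : int) (M : nat) : (0 < M)%N -> (absz (modz k M%:Z) < M)%N.
Proof.
move=> M0; have M0' : M%:Z != 0 by lia.
by have := modz_ge0 k M0'; have := ltz_mod k M0'; lia.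
Qed.

Lemma glued_subgroup N M H : (0 < M)%N ->
  (forall k, (k < M)%N -> is_subgroupA (H k)) -> is_subgroupA (glued N M H).
Proof.
move=> M0 HS; have HS' k := HS _ (absz_modz_lt k M0).
split=> [|x y /asboolP Hx /asboolP Hy|x /asboolP Hx]; apply/asboolP => k.
- by rewrite block_zero; case: (HS' k).
- by rewrite block_add; case: (HS' k) => _ Ha _; apply: Ha.
- by rewrite block_opp; case: (HS' k) => _ _ Ho; apply: Ho.
Qed.

Lemma glued_periodic N M H w : glued N M H (shift (- (M * N)%N%:Z) w) = glued N M H w.
Proof.
have E k : block N k (shift (- (M * N)%N%:Z) w) = block N (k - M%:Z) w.
  by rewrite -block_shift PoszM.
apply: asbool_equiv_eq; split=> Hw k.
  have := Hw (k + M%:Z); rewrite E // addrK.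
  by rewrite modzDr.
have := Hw (k - M%:Z); rewrite E //.
by rewrite -[in X in X -> _](modzDr (k - M%:Z)) subrK.
Qed.

(** The conditions on [i] and [b] place the translated support of [w] entirely inside block [k]. All
    other blocks vanish and pass their test, which leaves only the test by [H k]. *)
Lemma glued_window N M H (k i b : nat) w : (0 < M)%N ->
  (forall k, (k < M)%N -> is_subgroupA (H k)) ->
  (k < M)%N -> (b <= i)%N -> (i + b < N)%N ->
  (forall j : int, (b < `|j|)%N -> sval w j = 0) ->
  glued N M H (shift (- (k * N + i)%N%:Z) w) = H k (shift (- i%:Z) w).
Proof.
move=> M0 HS kM bi iN wb.
have kE : absz (modz k%:Z M%:Z) = k by rewrite modz_nat absz_nat modn_small.
have B1 : block N k%:Z (shift (- (k * N + i)%N%:Z) w) = shift (- i%:Z) w.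
  apply: Anp_ext => j /=; case: ifP => [_|jN].
    by congr (sval w _); rewrite PoszD PoszM; ring.
  by rewrite wb //; move: jN; lia.
(* A block other than [k] is displaced by at least [N], hence reads [w] only at positions beyond [b]
   in absolute value. *)
have B2 (l : int) : l != k%:Z -> block N l (shift (- (k * N + i)%N%:Z) w) = Azero n p.
  move=> lk; apply: Anp_ext => j /=; case: ifP => // jN; apply: wb.
  have -> : j + l * N%:Z + - (k * N + i)%N%:Z = j + (l - k%:Z) * N%:Z - i%:Z.
    by rewrite PoszD PoszM; ring.
  set d := l - k%:Z; have d0 : d != 0 by rewrite subr_eq0.
  have [d1|d1] : (1 <= d) \/ (d <= -1) by lia.
    by have : N%:Z <= d * N%:Z by [apply: ler_peMl]; move: jN; lia.
  by have : N%:Z <= - d * N%:Z by [apply: ler_peMl => //; lia]; move: jN; lia.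
apply/asboolP/idP => [/(_ k%:Z)|Hk l]; first by rewrite kE B1.
have [->|lk] := eqVneq l k%:Z; first by rewrite kE B1.
by rewrite B2 //; case: (HS _ (absz_modz_lt l M0)).
Qed.

Lemma iter_tauS (t : nat) (H : SpA n p) w :
  iter t (@tauS n p) H w = H (shift (- t%:Z) w).
Proof.
elim: t w => [|t IH] w; first by rewrite oppr0 Anp_shift0.
by rewrite iterS /tauS IH Anp_shiftD; congr H; congr shift; lia.
Qed.

End Anp_theory.

Section product_maps.
Variables (I J : Type) (e : nat -> I) (e' : nat -> J).
Hypotheses (e_surj : forall i, exists k, e k = i)
  (e_surj' : forall i, exists k, e' k = i).
Local Notation X := (prod_topology (fun _ : I => bool)).
Local Notation Y := (prod_topology (fun _ : J => bool)).

Lemma prod_map_continuous (f : X -> Y) :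
  (forall j, exists i, forall x y : X, x i = y i -> f x j = f y j) ->
  continuous f.
Proof.
move=> Hf x U /(prod_coords_nbhs e_surj') [m Hm].
have H k : exists l, forall y : X, x (e l) = y (e l) -> f x (e' k) = f y (e' k).
  by have [i Hi] := Hf (e' k); have [l le] := e_surj i; exists l => y;
    rewrite le => /Hi.
have [g Hg] := choice H.
apply/(prod_coords_nbhs e_surj); exists (\max_(k < m) (g k).+1)%N => y xy.
apply: Hm => k km; apply: Hg; apply: xy.
exact: (@leq_bigmax _ (fun k : 'I_m => (g k).+1) (Ordinal km)).
Qed.

(** A condition that only ever involves three coordinates at once is closed; three are what the
    product axiom of a subgroup uses, namely two elements and their product. *)
Lemma prod_closed (C : set X) :
  (forall x : X, (forall a b d : I, exists y : X,
    [/\ C y, x a = y a, x b = y b & x d = y d]) -> C x) -> closed C.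
Proof.
move=> H x Cx; apply: H => a b d.
have [ka kaE] := e_surj a; have [kb kbE] := e_surj b; have [kd kdE] := e_surj d.
have [|y [Cy xy]] := Cx [set y | agree (fun k (z : X) => z (e k))
    (maxn ka (maxn kb kd)).+1 x y].
  by apply/(prod_coords_nbhs e_surj); exists (maxn ka (maxn kb kd)).+1.
exists y; rewrite -kaE -kbE -kdE; split => //; apply: xy;
  by rewrite ltnS ?leq_max ?leqnn ?orbT.
Qed.

End product_maps.

(** * The simplex of shift-invariant measures on Sub(A) *)

Section SubA_poulsen.
Variables (R : realType) (n p : nat).

Lemma SubA_closed : closed (SubA n p).
Proof.
have [e He] := Anp_enum n p; apply: (prod_closed He) => H HH; split.
- by have [K [[K0 _ _] -> _ _]] := HH (Azero n p) (Azero n p) (Azero n p).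
- move=> x y Hx Hy; have [K [[_ Ka _] xE yE ->]] := HH x y (Aadd x y).
  by apply: Ka; rewrite -?xE -?yE.
- move=> x Hx; have [K [[_ _ Ko] xE yE _]] := HH x (Aopp x) (Azero n p).
  by rewrite yE; apply: Ko; rewrite -xE.
Qed.

Lemma tauS_continuous : continuous (@tauS n p).
Proof.
have [e He] := Anp_enum n p; apply: (prod_map_continuous He He) => w.
by exists (shift (-1) w) => x y; rewrite /tauS.
Qed.

Lemma tauS_SubA H : SubA n p H -> SubA n p (tauS H).
Proof.
case=> H0 Ha Ho; split; rewrite /tauS.
- by rewrite shift_zero.
- by move=> x y Hx Hy; rewrite shift_add; apply: Ha.
- by move=> x Hx; rewrite shift_opp; apply: Ho.
Qed.

Lemma SpA_coords (e : nat -> Anp n p) : (forall x, exists k, e k = x) ->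
  cantor_coords (fun k (H : SpA n p) => H (e k)).
Proof.
move=> He; split; first exact: (prod_coords_nbhs He).
exact: prod_coords_compact.
Qed.

Lemma IRS_tau_inv_on :
  IRS_tau R n p = inv_on (SubA n p) (fun _ : unit => @tauS n p).
Proof.
by apply/seteqP; split => mu [S1 I1]; split => //; exact: I1 tt.
Qed.

Lemma IRS_tau_poulsen : poulsen_simplex (IRS_tau R n p).
Proof.
have [e He] := Anp_enum n p; rewrite IRS_tau_inv_on.
apply: (inv_on_poulsen R (SpA_coords He)).
- exact: SubA_closed.
- exact: tauS_continuous.
- exact: tauS_SubA.
(* Agreement at level [m] tests membership of the first [m] enumerated elements only; the margin is
   a common bound for their supports. *)
move=> m; exists (\max_(k < m) Anp_bound (e k))%N => N M H N0 M0 HS.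
exists (glued N M H); split.
- exact: glued_subgroup.
- by apply/funext => w; rewrite iter_tauS glued_periodic.
- move=> k i kM mi iN l lm; rewrite !iter_tauS.
  have bl : (Anp_bound (e l) <= \max_(k < m) Anp_bound (e k))%N.
    exact: (@leq_bigmax _ (fun k : 'I_m => Anp_bound (e k)) (Ordinal lm)).
  apply: (glued_window (b := \max_(k < m) Anp_bound (e k))%N) => //.
  by move=> j bj; apply: Anp_boundP; apply: leq_ltn_trans bj.
Qed.

End SubA_poulsen.

(** * Transport to subgroups of L *)

Section prob_facts.
Variables (R : realType) (d : measure_display) (T : measurableType d).
Implicit Type mu : probability T R.

Lemma prob1_sub mu (A B : set T) : measurable A -> measurable B ->
  A `<=` B -> mu A = 1%E -> mu B = 1%E.
Proof.
move=> mA mB AB A1; apply/eqP; rewrite eq_le probability_le1 // -A1.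
by rewrite le_measure // inE.
Qed.

Lemma prob1_eq mu (S A B : set T) : measurable S -> measurable A ->
  measurable B -> mu S = 1%E -> A `&` S = B `&` S -> mu A = mu B.
Proof.
move=> mS mA mB S1 AB.
have S0 : mu (~` S) = 0%E.
  by transitivity (1 - mu S)%E; [exact: probability_setC|rewrite S1 subee].
have r : realmeas (fun A : set T => fine (mu A)).
  by apply: realmeas_fine; rewrite -ge0_fin_numE // fin_num_measure.
have null C : measurable C -> fine (mu (C `&` ~` S)) = 0.
  move=> mC; apply/eqP; rewrite eq_le fine_ge0 // andbT.
  have -> : 0 = fine (mu (~` S)) by rewrite S0.
  by apply: (realmeas_le r) => //; [apply: measurableI => //|]; apply: measurableC.
rewrite -(fineK (fin_num_measure mu A mA)) -(fineK (fin_num_measure mu B mB)).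
congr (_%:E); rewrite (realmeasU r mA mS) (realmeasU r mB mS) AB.
by rewrite !null.
Qed.

Lemma prob1I mu (A B : set T) : measurable A -> measurable B ->
  mu (A `&` B) = 1%E <-> mu A = 1%E /\ mu B = 1%E.
Proof.
move=> mA mB; have mAB := measurableI _ _ mA mB; split=> [H|[HA HB]].
  by split; apply: prob1_sub H => // x [].
rewrite -HB; apply: (prob1_eq mA) => //.
by rewrite setIAC setIid setIC.
Qed.

End prob_facts.

Lemma image_prob (R : realType) (X Y : ptopologicalType)
    (nu : probability (Borel X) R) (j : X -> Y) : continuous j ->
  exists mu : probability (Borel Y) R,
    forall B : set (Borel Y), measurable B -> mu B = nu ((j : Borel X ->
      Borel Y) @^-1` B).
Proof.
move=> cj.
have mj : measurable_fun setT (j : Borel X -> Borel Y) by exact: continuous_borel.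
have [m mE] : exists m : {measure set (Borel Y) -> \bar R},
    forall B, m B = nu ((j : Borel X -> Borel Y) @^-1` B).
  by unshelve eexists (@pushforward _ _ (Borel X) (Borel Y) R nu j).
exists (mnormalize m (@dirac _ (Borel Y) point R)) => B mB.
transitivity (mnormalize m (@dirac _ (Borel Y) point R) B); first by [].
rewrite /mnormalize !mE preimage_setT.
have -> : nu setT = 1%E by exact: probability_setT.
by rewrite onee_eq0 /= invr1 mule1.
Qed.

Section L_theory.
Variables (R : realType) (n p : nat).

Lemma SpL_coords (e : nat -> Lnp n p) : (forall x, exists k, e k = x) ->
  cantor_coords (fun k (V : SpL n p) => V (e k)).
Proof.
move=> He; split; first exact: (prod_coords_nbhs He).
exact: prod_coords_compact.
Qed.

Lemma SubL_closed : closed (SubL n p).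
Proof.
have [e He] := Lnp_enum n p; apply: (prod_closed He) => H HH; split.
- by have [K [[K0 _ _] -> _ _]] := HH (Lone n p) (Lone n p) (Lone n p).
- move=> x y Hx Hy; have [K [[_ Ka _] xE yE ->]] := HH x y (Lmul x y).
  by apply: Ka; rewrite -?xE -?yE.
- move=> x Hx; have [K [[_ _ Ko] xE yE _]] := HH x (Linv x) x.
  by rewrite yE; apply: Ko; rewrite -xE.
Qed.

Lemma pi1_zero_closed : closed (pi1_zero n p).
Proof.
have [e He] := Lnp_enum n p; apply: (prod_closed He) => H HH x Hx.
by have [K [K0 xE _ _]] := HH x x x; apply: K0; rewrite -xE.
Qed.

Lemma conjS_continuous g : continuous (@conjS n p g).
Proof.
have [e He] := Lnp_enum n p; apply: (prod_map_continuous He He) => w.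
by exists (Lmul (Lmul (Linv g) w) g) => x y; rewrite /conjS.
Qed.

Definition SubL0 : set (SpL n p) := SubL n p `&` pi1_zero n p.

Lemma SubL0_closed : closed SubL0.
Proof. apply: closedI; [exact: SubL_closed|exact: pi1_zero_closed]. Qed.

Lemma IRS_0_inv_on : IRS_0 R n p = inv_on SubL0 (@conjS n p).
Proof.
have mS : measurable (SubL n p : set (Borel (SpL n p))).
  by apply: closed_borel; exact: SubL_closed.
have m0 : measurable (pi1_zero n p : set (Borel (SpL n p))).
  by apply: closed_borel; exact: pi1_zero_closed.
apply/seteqP; split=> mu.
  by case=> S1 [I1 P1]; split => //; apply/prob1I.
by case=> /(prob1I mu mS m0) [S1 P1] I1.
Qed.

Definition emb (H : SpA n p) : SpL n p := fun g => H g.1 && (g.2 == 0).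
Definition base (V : SpL n p) : SpA n p := fun w => V (w, 0).

Lemma emb_continuous : continuous emb.
Proof.
have [e He] := Anp_enum n p; have [e' He'] := Lnp_enum n p.
apply: (prod_map_continuous He He') => g.
by exists g.1 => x y xy; rewrite /emb xy.
Qed.

Lemma base_continuous : continuous base.
Proof.
have [e He] := Anp_enum n p; have [e' He'] := Lnp_enum n p.
by apply: (prod_map_continuous He' He) => w; exists (w, 0).
Qed.

Lemma embK H : base (emb H) = H.
Proof. by apply/funext => w; rewrite /base /emb /= andbT. Qed.

Lemma baseK V : pi1_zero n p V -> emb (base V) = V.
Proof.
move=> V0; apply/funext => -[w k]; rewrite /emb /base /=.
have [->|k0] := eqVneq k 0; first by rewrite andbT.
rewrite andbF; apply/esym/negbTE; apply/negP => /V0 /= kE.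
by rewrite kE eqxx in k0.
Qed.

Lemma emb_SubL0 H : SubA n p H -> SubL0 (emb H).
Proof.
case=> H0 Ha Ho; split; last by move=> g /andP[_ /eqP].
split=> [|x y|x]; rewrite /emb /=.
- by rewrite H0 eqxx.
- move=> /andP[Hx /eqP ->] /andP[Hy /eqP ->].
  by rewrite Anp_shift0 Ha //= addr0 eqxx.
- by move=> /andP[Hx /eqP ->]; rewrite oppr0 Anp_shift0 Ho //= eqxx.
Qed.

Lemma base_SubA V : SubL n p V -> SubA n p (base V).
Proof.
case=> V0 Va Vo; split; rewrite /base.
- exact: V0.
- by move=> x y Vx Vy; have := Va _ _ Vx Vy; rewrite /Lmul /= Anp_shift0 addr0.
- by move=> x Vx; have := Vo _ Vx; rewrite /Linv /= oppr0 Anp_shift0.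
Qed.

(** Since [A] is abelian the [A]-component of [g] cancels: conjugation acts on [A] through the shift
    alone, which turns conjugation invariance into shift invariance. *)
Lemma conj_base (g : Lnp n p) (x : Anp n p) :
  Lmul (Lmul (Linv g) (x, 0)) g = (shift (- g.2) x, 0).
Proof.
case: g => w k; rewrite /Lmul /Linv /=; congr (_, _); last by rewrite addr0 addNr.
by apply: Anp_ext => i /=; rewrite addr0 addrAC addNr add0r.
Qed.

Definition shiftS (k : int) (H : SpA n p) : SpA n p := fun w => H (shift (- k) w).

Lemma conj_emb g H : conjS g (emb H) = emb (shiftS g.2 H).
Proof.
apply/funext => -[x k]; rewrite /conjS; have [->|k0] := eqVneq k 0.
  by rewrite conj_base /emb /shiftS.
rewrite /emb /=; rewrite (negbTE k0) andbF.
by apply/negbTE; rewrite negb_and; apply/orP; right; lia.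
Qed.

Lemma base_conj V : base (conjS (Azero n p, 1) V) = tauS (base V).
Proof. by apply/funext => w; rewrite /base /conjS conj_base. Qed.

Lemma shiftS_continuous k : continuous (shiftS k).
Proof.
have [e He] := Anp_enum n p; apply: (prod_map_continuous He He) => w.
by exists (shift (- k) w).
Qed.

Lemma shiftS_inv (nu : probability (Borel (SpA n p)) R) k :
  invariant_under (@tauS n p) nu -> invariant_under (shiftS k) nu.
Proof.
move=> Inu.
have [e He] := Anp_enum n p.
have pos (m : nat) : invariant_under (shiftS m%:Z) nu.
  move=> B mB; rewrite -[RHS](proj2 (invariant_iter m (@tauS_continuous n p) Inu mB)).
  by congr (nu _); apply/seteqP; split => H /=;
    rewrite (_ : iter m _ H = shiftS m%:Z H) //; apply/funext => w; rewrite iter_tauS.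
case: (intP k) => [|m|m]; [exact: (pos 0%N)|exact: (pos m.+1)|].
move=> B mB; have mB' := measurable_preimage (shiftS_continuous (k := - m.+1%:Z)) mB.
rewrite -(pos m.+1 _ mB'); congr (nu _); apply/seteqP; split => H /=;
  by rewrite (_ : shiftS _ (shiftS _ H) = H) //; apply/funext => w;
     rewrite /shiftS Anp_shiftD opprK ?subrr ?addNr Anp_shift0.
Qed.

Lemma image_base (mu : probability (Borel (SpL n p)) R)
    (nu : probability (Borel (SpA n p)) R) : IRS_0 R n p mu ->
  (forall B : set (Borel (SpA n p)), measurable B ->
    nu B = mu ((base : Borel (SpL n p) -> Borel (SpA n p)) @^-1` B)) ->
  IRS_tau R n p nu.
Proof.
move=> [S1 [I1 P1]] nuE.
have mA : measurable (SubA n p : set (Borel (SpA n p))).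
  by apply: closed_borel; exact: SubA_closed.
have mb := measurable_preimage base_continuous.
split.
  rewrite nuE //; apply: prob1_sub S1; [|exact: mb|exact: base_SubA].
  by apply: closed_borel; exact: SubL_closed.
move=> B mB; rewrite !nuE //;
  last exact: (measurable_preimage (@tauS_continuous n p)).
rewrite -[RHS](I1 (Azero n p, 1)); last exact: mb.
by congr (mu _); apply/seteqP; split => V /=; rewrite base_conj.
Qed.

Lemma image_emb (nu : probability (Borel (SpA n p)) R)
    (mu : probability (Borel (SpL n p)) R) : IRS_tau R n p nu ->
  (forall B : set (Borel (SpL n p)), measurable B ->
    mu B = nu ((emb : Borel (SpA n p) -> Borel (SpL n p)) @^-1` B)) ->
  IRS_0 R n p mu.
Proof.
move=> [S1 I1] muE; rewrite IRS_0_inv_on.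
have m0 : measurable (SubL0 : set (Borel (SpL n p))).
  by apply: closed_borel; exact: SubL0_closed.
have me := measurable_preimage emb_continuous.
split.
  rewrite muE //; apply: prob1_sub S1; [|exact: me|exact: emb_SubL0].
  by apply: closed_borel; exact: SubA_closed.
move=> g B mB; rewrite !muE //;
  last exact: (measurable_preimage (@conjS_continuous g)).
rewrite -[RHS](shiftS_inv g.2 I1); last exact: me.
by congr (nu _); apply/seteqP; split => H /=; rewrite conj_emb.
Qed.

Lemma emb_base_ae (mu : probability (Borel (SpL n p)) R) (B : set (Borel (SpL n p))) :
  IRS_0 R n p mu -> measurable B ->
  mu (((emb \o base) : Borel (SpL n p) -> Borel (SpL n p)) @^-1` B) = mu B.
Proof.
move=> [_ [_ P1]] mB.
have m0 : measurable (pi1_zero n p : set (Borel (SpL n p))).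
  by apply: closed_borel; exact: pi1_zero_closed.
apply: (prob1_eq m0 _ mB P1).
  apply: (measurable_preimage (f := emb \o base)) => // V.
  by apply: continuous_comp; [exact: base_continuous|exact: emb_continuous].
by apply/seteqP; split => V /= [BV V0]; split => //; move: BV; rewrite baseK.
Qed.

(** Pushforwards along [base] and [emb] are mutually inverse between [IRS_0] and [IRS_tau]. Push
    [mu] down, approximate it there by an extreme point, and push that point back up. *)
Lemma IRS_0_poulsen : poulsen_simplex (IRS_0 R n p).
Proof.
have [e He] := Anp_enum n p; have [e' He'] := Lnp_enum n p.
have cA := SpA_coords He; have cL := SpL_coords He'.
split.
  rewrite IRS_0_inv_on;
    exact: (@inv_on_simplex R _ _ cL SubL0 _
      (@conjS n p) SubL0_closed conjS_continuous).
move=> mu Kmu q f cf eps e0.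
have [rmu rmuE] := image_prob mu base_continuous.
have Krmu := image_base Kmu rmuE.
have cfe i : continuous (f i \o emb).
  by move=> H; apply: continuous_comp; [exact: emb_continuous|exact: cf].
have [nu [[Knu ext_nu] Hnu]] := (IRS_tau_poulsen R n p).2 rmu Krmu q _ cfe eps e0.
have [jnu jnuE] := image_prob nu emb_continuous.
have Kj := image_emb Knu jnuE.
exists jnu; split; last first.
  move=> i; have := Hnu i.
  rewrite (integral_image cA cL emb_continuous (fun B mB => esym (jnuE B mB)) (cf i)).
  rewrite (integral_image cL cA base_continuous (fun B mB => esym (rmuE B mB))
    (cfe i)).
  congr (`| _ - _ | < _)%E; apply/esym.
  apply: (integral_image (j := emb \o base) cL cL) => //.
    by move=> V; apply: continuous_comp;
      [exact: base_continuous|exact: emb_continuous].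
  by move=> B mB; exact: emb_base_ae.
split => // m1 m2 t K1 K2 t01 H B mB.
have [r1 r1E] := image_prob m1 base_continuous.
have [r2 r2E] := image_prob m2 base_continuous.
have mb := measurable_preimage base_continuous.
have me := measurable_preimage emb_continuous.
(* Extremality of [jnu]: push the decomposition down along [base], where [nu] is extreme; equality
   of the images on the preimage of [B] under [emb] is equality on [B]. *)
rewrite -(emb_base_ae K1 mB) -(emb_base_ae K2 mB).
have := ext_nu r1 r2 t (image_base K1 r1E) (image_base K2 r2E) t01 _ _ (me _ mB).
rewrite r1E; last exact: me.
rewrite r2E; last exact: me.
apply=> D mD; rewrite r1E // r2E // -H; last exact: mb.
rewrite jnuE; last exact: mb.
by congr (nu _); apply/seteqP; split => V /=; rewrite embK.
Qed.

End L_theory.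

(** * The perfect kernel *)

Section perfect.
Variables (X : ptopologicalType) (c : nat -> X -> bool).
Hypothesis cX : cantor_coords c.
Hypothesis c_sep : forall x y, (forall k, c k x = c k y) -> x = y.

(** Should [x] be [z] itself, a perfect set has another point in the same cylinder; a point distinct
    from [z] is told apart from it at some finite level. *)
Lemma perfect_step (P : set X) (m : nat) (x z : X) : limit_point P = P -> P x ->
  exists y m', [/\ P y, (m <= m')%N, agree c m x y & ~ agree c m' y z].
Proof.
move=> PP Px.
have sep y : y <> z -> exists m', (m <= m')%N /\ ~ agree c m' y z.
  move=> yz; apply: contrapT => no; apply: yz; apply: c_sep => k.
  apply: contrapT => ck; apply: no; exists (maxn m k.+1).
  split; first exact: leq_maxl.
  by move=> ag; apply/ck/ag; rewrite leq_max ltnSn orbT.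
have [xz|xz] := pselect (x = z); last first.
  by have [m' [mm' nag]] := sep _ xz; exists x, m'.
have [y [/eqP yx Py xy]] : exists y, [/\ y != x, P y & agree c m x y].
  move: Px; rewrite -{1}PP => /(_ [set y | agree c m x y]); apply.
  by apply/(coords_nbhs cX); exists m.
have [|m' [mm' nag]] := sep y; first by rewrite -xz.
by exists y, m'.
Qed.

(** Cantor's diagonal argument: nested cylinders centred in [P] successively exclude every point of
    a supposed enumeration, while compactness leaves a point in all of them. *)
Lemma perfect_uncountable (P : set X) (x0 : X) (m0 : nat) :
  perfect_set P -> P x0 -> ~ countable [set y | P y /\ agree c m0 x0 y].
Proof.
move=> [cP PP] Px0; set A := [set y | _] => /countable_injP [f finj].
(* A state [(x, m)] stands for the [m]-cylinder around [x]; stage [k] refines it so as to miss the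
   point numbered [k], if there is one. *)
have step (kp : nat * (X * nat)) : exists p' : X * nat, P kp.2.1 ->
  [/\ P p'.1, (kp.2.2 <= p'.2)%N, agree c kp.2.2 kp.2.1 p'.1 &
    forall z, A z -> f z = kp.1 -> ~ agree c p'.2 p'.1 z].
  case: kp => k [x m] /=.
  have [Px|] := pselect (P x); last by exists (x, m).
  have [[z [Az fz]]|no] := pselect (exists z, A z /\ f z = k); last first.
    exists (x, m) => _; split => // z Az fz; exfalso; apply: no; by exists z.
  have [y [m' [Py mm' xy yz]]] := perfect_step m z PP Px.
  exists (y, m') => _; split => // z' Az' fz'.
  by rewrite (finj z' z) ?fz' ?fz //; exact/mem_set.
have [s Hs] := choice step.
pose u := fix u k := if k is k'.+1 then s (k', u k') else (x0, m0).
have Pu k : P (u k).1.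
  by elim: k => //= k IH; case: (Hs (k, u k) IH).
have uS k : [/\ ((u k).2 <= (u k.+1).2)%N, agree c (u k).2 (u k).1 (u k.+1).1 &
    forall z, A z -> f z = k -> ~ agree c (u k.+1).2 (u k.+1).1 z].
  by case: (Hs (k, u k) (Pu k)).
have um k j : ((u k).2 <= (u (k + j)%N).2)%N /\
    agree c (u k).2 (u k).1 (u (k + j)%N).1.
  elim: j => [|j [IH1 IH2]]; first by rewrite addn0.
  rewrite addnS; have [m1 a1 _] := uS (k + j)%N; split; first exact: leq_trans m1.
  by apply: agree_trans IH2 _; apply: agreeW a1.
have [y [_ cly]] : [set: X] `&` cluster ((fun k => (u k).1) @ \oo) !=set0.
  by apply: (coords_compact cX); exact: filterT.
have near_y k m : exists2 j, (k <= j)%N & agree c m y (u j).1.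
  have := cly [set z | exists2 j, (k <= j)%N & z = (u j).1] [set z | agree c m y z].
  case.
  - by exists k => // j /= kj; exists j.
  - by apply/(coords_nbhs cX); exists m.
  by move=> z [[j kj ->] yj]; exists j.
have uy k : agree c (u k).2 (u k).1 y.
  have [j kj yj] := near_y k (u k).2.
  apply: agree_trans _ (agree_sym yj).
  by have [_] := um k (j - k)%N; rewrite subnKC.
have Ay : A y.
  split; last exact: (uy 0%N).
  apply: cP => U /(coords_nbhs cX) [m mU].
  by have [j _ yj] := near_y 0%N m; exists (u j).1; split => //; apply: mU.
by have [_ _ /(_ y Ay erefl)] := uS (f y); apply; exact: uy.
Qed.

End perfect.

(** * Identification of the perfect kernel *)

Section kernel.
Variables n p : nat.
Local Notation A := (Anp n p).

Lemma restrict_fin (P : pred int) (x : A) : exists N : nat, forall i : int,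
  (N < `|i|)%N -> (fun i => if P i then sval x i else 0) i = 0.
Proof. by exists (Anp_bound x) => i /Anp_boundP ->; case: ifP. Qed.

Definition restrict (P : pred int) (x : A) : A := exist _ _ (restrict_fin P x).

Lemma delta_fin (i0 : int) (v : 'rV['F_p]_n) : exists N : nat, forall i : int,
  (N < `|i|)%N -> (fun i => if i == i0 then v else 0) i = 0.
Proof. by exists `|i0|%N => i; case: eqP => // ->; rewrite ltnn. Qed.

Definition delta (i0 : int) (v : 'rV['F_p]_n) : A := exist _ _ (delta_fin i0 v).

Lemma restrict_id (P : pred int) x : (forall i, ~~ P i -> sval x i = 0) ->
  restrict P x = x.
Proof. by move=> H; apply: Anp_ext => i /=; case: ifPn => // /H ->. Qed.

Lemma restrict0 P : restrict P (Azero n p) = Azero n p.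
Proof. by apply: Anp_ext => i /=; case: ifP. Qed.

Lemma restrictD P x y : restrict P (Aadd x y) = Aadd (restrict P x) (restrict P y).
Proof. by apply: Anp_ext => i /=; case: ifP; rewrite ?addr0. Qed.

Lemma restrictN P x : restrict P (Aopp x) = Aopp (restrict P x).
Proof. by apply: Anp_ext => i /=; case: ifP; rewrite ?oppr0. Qed.

Lemma subgroup_restrict P (H : A -> bool) : is_subgroupA H ->
  is_subgroupA (fun x => H (restrict P x)).
Proof.
case=> H0 Ha Ho; split=> [|x y Hx Hy|x Hx].
- by rewrite restrict0.
- by rewrite restrictD; apply: Ha.
- by rewrite restrictN; apply: Ho.
Qed.

Lemma subgroup_supported P (H : A -> bool) : is_subgroupA H ->
  is_subgroupA (fun x => H x && `[< restrict P x = x >]).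
Proof.
case=> H0 Ha Ho;
  split=> [|x y /andP[Hx /asboolP xE] /andP[Hy /asboolP yE]|x /andP[Hx /asboolP xE]].
- by rewrite H0; apply/asboolP; exact: restrict0.
- by rewrite Ha //; apply/asboolP; rewrite restrictD xE yE.
- by rewrite Ho //; apply/asboolP; rewrite restrictN xE.
Qed.

(** Two distinct subgroups share with [H] all elements supported in [-b, b]: [H1], made of these
    elements only, and [H2], the preimage of [H] under restriction to that interval. At least one of
    them differs from [H]. *)
Lemma SubL0_perfect : (0 < n)%N -> perfect_set (@SubL0 n p).
Proof.
move=> n0; have cS := @SubL0_closed n p; split => //.
apply/seteqP; split=> V.
  by move=> lV; apply: cS => U /lV [y [_ Sy Uy]]; exists y.
move=> [SV V0]; have [e He] := Lnp_enum n p.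
move=> U /(coords_nbhs (SpL_coords He)) [m mU].
pose b := (\max_(k < m) Anp_bound (e k).1)%N.
pose P : pred int := fun i => (`|i| <= b)%N.
pose H := base V; have SH : is_subgroupA H := base_SubA SV.
have eb k : (k < m)%N -> restrict P (e k).1 = (e k).1.
  move=> km; apply: restrict_id => i; rewrite /P -ltnNge => bi.
  apply: Anp_boundP; apply: leq_ltn_trans bi.
  exact: (@leq_bigmax _ (fun k : 'I_m => Anp_bound (e k).1) (Ordinal km)).
pose H1 : SpA n p := fun x => H x && `[< restrict P x = x >].
pose H2 : SpA n p := fun x => H (restrict P x).
have VE : V = emb H by rewrite /H baseK.
have S1 : SubL0 (emb H1) by apply: emb_SubL0; exact: subgroup_supported.
have S2 : SubL0 (emb H2) by apply: emb_SubL0; exact: subgroup_restrict.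
have U1 : U (emb H1).
  apply: mU => k km; rewrite VE /emb /H1; congr andb.
  by rewrite (asboolT (eb k km)) andbT.
have U2 : U (emb H2).
  by apply: mU => k km; rewrite VE /emb /H2 eb.
have H12 : emb H1 <> emb H2.
  pose v : 'rV['F_p]_n := const_mx 1.
  have v0 : v <> 0.
    by move=> /rowP /(_ (Ordinal n0)); rewrite !mxE => /eqP; rewrite oner_eq0.
  (* Supported just outside the interval, [x] restricts to zero and so belongs to [H2], but not to
     [H1]. *)
  pose x := delta b.+1%:Z v.
  have xP : restrict P x = Azero n p.
    by apply: Anp_ext => i /=; case: ifP => // Pi; case: eqP => // ib; move: Pi;
      rewrite /P ib ltnn.
  move=> /(congr1 (fun V : SpL n p => V (x, 0))); rewrite /emb /= !andbT /H1 /H2 xP.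
  case: SH => -> _ _ /andP[_ /asboolP] /(congr1 (fun y => sval y b.+1%:Z)) /=.
  by rewrite eqxx => /esym.
have [E1|/eqP N1] := pselect (emb H1 = V); last by exists (emb H1); split.
exists (emb H2); split => //; apply/eqP => E2; apply: H12.
by rewrite E1 E2.
Qed.

Lemma LmulVK (g h : Lnp n p) : Lmul (Lmul g (Linv h)) h = g.
Proof.
case: g h => [x k] [y l]; rewrite /Lmul /Linv /=; congr (_, _); last by rewrite subrK.
apply: Anp_ext => i /=; rewrite -addrA.
have -> : i + k - l = i + (k - l) by rewrite addrA.
by rewrite addNr addr0.
Qed.

Lemma LinvK (g : Lnp n p) : Linv (Linv g) = g.
Proof.
case: g => [x k]; rewrite /Linv /=; congr (_, _); last by rewrite opprK.
by apply: Anp_ext => i /=; rewrite !opprK addrK.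
Qed.

Definition window (d : nat) (x : A) :=
  forall i : int, ~~ ((0 <= i) && (i < d%:Z)) -> sval x i = 0.

Definition ext (d : nat) (phi : {ffun 'I_d -> 'rV['F_p]_n}) : int -> 'rV['F_p]_n :=
  fun i => if insub `|i|%N is Some j then if 0 <= i then phi j else 0 else 0.

Lemma ext_fin d phi : exists N : nat, forall i : int, (N < `|i|)%N ->
  @ext d phi i = 0.
Proof. by exists d => i di; rewrite /ext insubF //; lia. Qed.

Definition extA d phi : A := exist _ _ (@ext_fin d phi).

Lemma window_ext d x : window d x -> exists phi, x = @extA d phi.
Proof.
move=> wx; exists [ffun j : 'I_d => sval x j%:Z]; apply: Anp_ext => i /=.
rewrite /ext; case: insubP => [j jd jE|jd]; last by apply: wx; move: jd; lia.
case: ifP => i0; last by apply: wx; rewrite i0.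
by rewrite ffunE jE; congr (sval x _); lia.
Qed.

(** * Finite generation of shift-invariant subgroups of A *)

Section shift_invariant.
Variables (H : A -> bool) (k : nat).
Hypotheses (SH : is_subgroupA H) (k0 : (0 < k)%N)
  (Hk : forall x, H x -> H (shift (- k%:Z) x)).

(** As in Hilbert's basis theorem, with elements supported in [0, d] read as vector polynomials of
    degree at most [d]: the possible coefficients of degree [d], zero included. *)
Definition lead (d : nat) : {set 'rV['F_p]_n} :=
  [set v | `[< exists x, [/\ H x, window d.+1 x & sval x d%:Z = v] >]]%SET.

Lemma window_shift d x : window d x -> window (d + k)%N (shift (- k%:Z) x).
Proof. by move=> wx i ik /=; apply: wx; move: ik; lia. Qed.

Lemma leadP d v : v \in lead d <-> exists x, [/\ H x, window d.+1 x & sval x d%:Z = v].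
Proof. by rewrite inE; split=> [/asboolP|?] //; apply/asboolP. Qed.

Lemma lead_sub d : lead d \subset lead (d + k)%N.
Proof.
apply/fintype.subsetP => v /leadP [x [Hx wx xv]]; apply/leadP.
exists (shift (- k%:Z) x); split; [exact: Hk| |].
  by rewrite -addSn; exact: window_shift.
by rewrite /= -xv; congr (sval x _); rewrite PoszD; ring.
Qed.

(* [\sum_(i < k) #|lead (d + i)|] is bounded and nondecreasing in [d]. *)
Lemma lead_stable : exists D, forall d, (D <= d)%N -> lead (d + k)%N = lead d.
Proof.
pose q d := (\sum_(i < k) #|lead (d + i)|)%N.
have qS d : (q d.+1 + #|lead d| = q d + #|lead (d + k)|)%N.
  rewrite /q; case: (k) => [|k']; first by rewrite !big_ord0 !add0n addn0.
  have E : (\sum_(i < k') #|lead (d + lift ord0 i)| = \sum_(i < k') #|lead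
    (d.+1 + i)|)%N.
    by apply: eq_bigr => i _; rewrite lift0 addSnnS.
  by rewrite big_ord_recr [in RHS]big_ord_recl E /= addn0 addSnnS addnC addnA.
have qm d : (q d <= q d.+1)%N.
  by have := subset_leq_card (lead_sub d); have := qS d; lia.
have qb d : (q d <= k * #|{: 'rV['F_p]_n}|)%N.
  rewrite -[X in (X * _)%N](card_ord k) -sum_nat_const.
  by apply: leq_sum => i _; exact: max_card.
have exP : exists i, `[< exists D, q D = i >] by exists (q 0%N); apply/asboolP;
  exists 0%N.
have ubP i : `[< exists D, q D = i >] -> (i <= k * #|{: 'rV['F_p]_n}|)%N.
  by move=> /asboolP [D <-].
case: (ex_maxnP exP ubP) => M /asboolP [D DM] Mmax; exists D => d Dd.
have mono : (q D <= q d)%N.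
  by rewrite -(subnKC Dd); elim: (d - D)%N => [|j IH]; rewrite ?addn0 ?addnS //;
    apply: leq_trans (qm _).
apply/esym/eqP; rewrite eqEcard lead_sub /=.
rewrite -(leq_add2l (q d)) -qS leq_add2r; apply: leq_trans mono; rewrite DM.
by apply: Mmax; apply: asboolT; exists d.+1.
Qed.

(* Cancelling the top coefficient reduces the length of the window. *)
Lemma window_generation : exists D, forall H' : A -> bool, is_subgroupA H' ->
  (forall x, H' x -> H' (shift (- k%:Z) x)) ->
  (forall x, H x -> window D x -> H' x) ->
  forall d x, H x -> window d x -> H' x.
Proof.
have [D HD] := lead_stable; have [_ Ha Ho] := SH.
exists (D + k)%N => H' [_ Ha' Ho'] Hk' base' d.
elim/ltn_ind: d => d IH x Hx wx.
have [dD|Dd] := leqP d (D + k)%N.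
  by apply: base' => // i iD; apply: wx; move: iD dD; lia.
case: d IH Dd wx => // d IH Dd wx.
have dk : (D <= d - k)%N by lia.
have kd : (k <= d)%N by lia.
have : sval x d%:Z \in lead (d - k + k)%N.
  by apply/leadP; exists x; rewrite subnK.
rewrite HD // => /leadP [y [Hy wy yx]].
have H'y : H' y by apply: (IH (d - k).+1) => //; lia.
pose z := shift (- k%:Z) y.
have Hz : H z by exact: Hk.
have wz : window d.+1 z.
  by move=> i id /=; apply: wy; move: id; lia.
have zx : sval z d%:Z = sval x d%:Z.
  by rewrite /= -yx; congr (sval y _); lia.
have H'd : H' (Aadd x (Aopp z)).
  apply: (IH d) => //; first by apply: Ha => //; exact: Ho.
  move=> i id; have [->|nid] := eqVneq i d%:Z; first by rewrite /= -zx subrr.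
  have nid' : ~~ ((0 <= i) && (i < d.+1%:Z)) by move: id nid; lia.
  by change (sval x i - sval z i = 0); rewrite (wx _ nid') (wz _ nid') subrr.
have -> : x = Aadd (Aadd x (Aopp z)) z by apply: Anp_ext => i /=; rewrite subrK.
by apply: Ha' => //; exact: Hk'.
Qed.

Lemma shift_iter (K : A -> bool) (l : int) (m : nat) x :
  (forall x, K x -> K (shift l x)) -> K x -> K (shift (m%:Z * l) x).
Proof.
move=> Kl Kx; elim: m => [|m IH]; first by rewrite mul0r Anp_shift0.
have -> : m.+1%:Z * l = l + m%:Z * l by rewrite (_ : m.+1%:Z
  = 1 + m%:Z) // mulrDl mul1r.
by rewrite -Anp_shiftD; apply: Kl.
Qed.

(** A shift by a large multiple of [k] moves any element to nonnegative positions, where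
    [window_generation] applies; invariance of [H'] in the other direction brings it back. *)
Lemma subgroup_generation : exists D, forall H' : A -> bool, is_subgroupA H' ->
  (forall x, H' x -> H' (shift (- k%:Z) x)) ->
  (forall x, H' x -> H' (shift k%:Z x)) ->
  (forall x, H x -> window D x -> H' x) -> forall x, H x -> H' x.
Proof.
have [D HD] := window_generation; exists D => H' SH' Hm Hp base' x Hx.
pose b := Anp_bound x.
have Hy : H (shift (b%:Z * - k%:Z) x) by exact: shift_iter.
have bk : (b <= b * k)%N by rewrite leq_pmulr.
have -> : x = shift (b%:Z * k%:Z) (shift (b%:Z * - k%:Z) x).
  by rewrite Anp_shiftD mulrN subrr Anp_shift0.
apply: shift_iter => //.
apply: (HD H' SH' Hm base' (b * k + b).+1) => // i ib /=.
apply: Anp_boundP; rewrite -/b mulrN -PoszM; move: ib; lia.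
Qed.

End shift_invariant.

(** Generators are recorded by their indices in the enumeration [e], so that a subgroup is
    determined by a list of natural numbers. *)
Definition fin_generated (e : nat -> Lnp n p) (V : SpL n p) (s : seq nat) :=
  all (fun k => V (e k)) s /\ forall V' : SpL n p, is_subgroupL V' ->
    all (fun k => V' (e k)) s -> forall g, V g -> V' g.

Lemma base_conj_sub (V : SpL n p) g x : is_subgroupL V -> V g ->
  base V x -> base V (shift (- g.2) x).
Proof.
move=> [_ Va Vo] Vg Vx; rewrite /base -conj_base.
by apply: (Va) => //; apply: (Va) => //; apply: Vo.
Qed.

(** Generators are an element [g] with least positive projection [k], together with the finitely
    many elements of [base V] in a window of length [D]. Conjugation by [g] makes [base V]
    shift-invariant, so these generate it, and division by [g] reduces the rest of [V] to it. *)
Lemma subgroup_fin_generated (e : nat -> Lnp n p) (V : SpL n p) :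
  (forall g, exists k, e k = g) -> is_subgroupL V -> ~ pi1_zero n p V ->
  exists s, fin_generated e V s.
Proof.
move=> He SV V0; have [_ Va Vo] := SV.
have [idx Hidx] := choice He.
have exk : exists k : nat, (0 < k)%N && `[< exists w, V (w, k%:Z) >].
  have [g [Vg g0]] : exists g, V g /\ g.2 <> 0.
    by apply: contrapT => no; apply: V0 => g Vg; apply: contrapT => g0;
      apply: no; exists g.
  case: g Vg g0 => w l /= Vg l0.
  have [lp|ln] : 0 < l \/ l < 0 by lia.
    exists `|l|%N; rewrite absz_gt0; apply/andP; split; first by lia.
    by apply: asboolT; exists w; rewrite gtz0_abs.
  exists `|l|%N; rewrite absz_gt0; apply/andP; split; first by lia.
  apply: asboolT; exists (Linv (w, l)).1; rewrite ltz0_abs //.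
  exact: Vo _ Vg.
case: (ex_minnP exk) => k /andP[k0 /asboolP [w Vw]] kmin.
set g := (w, k%:Z) in Vw.
have SH := base_SubA SV.
have Hm x : base V x -> base V (shift (- k%:Z) x) by exact: (@base_conj_sub V g).
have [D HD] := subgroup_generation SH k0 Hm.
pose s := idx g :: [seq idx (extA phi, 0) |
  phi <- enum {ffun 'I_D -> 'rV['F_p]_n} & base V (extA phi)].
exists s; split.
  rewrite /= Hidx Vw all_map all_filter; apply/allP => phi _ /=.
  by apply/implyP; rewrite Hidx.
move=> V' SV' /= /andP[V'g]; rewrite Hidx in V'g.
rewrite all_map all_filter => /allP /= Hs.
have [_ Va' Vo'] := SV'.
have Hb : forall x, base V x -> base V' x.
  apply: HD; [exact: base_SubA| | |].
  - by move=> x; exact: (@base_conj_sub V' g).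
  - move=> x Hx; have := base_conj_sub SV' (Vo' _ V'g) Hx.
    by rewrite /= opprK.
  move=> x Hx /window_ext [phi xE].
  have := Hs phi; rewrite mem_enum => /(_ isT) /implyP; rewrite Hidx -xE; exact.
(* Descent on the projection: minimality of [k] gives [k <= l] when [l] is positive, and multiplying
   by the inverse of [g] lowers [l] by [k]. *)
have pos (l : nat) x : V (x, l%:Z) -> V' (x, l%:Z).
  elim/ltn_ind: l x => l IH x Vx.
  have [l0|l0] := posnP l; first by move: Vx; rewrite l0; exact: Hb.
  have kl : (k <= l)%N by apply: kmin; rewrite l0; apply: asboolT; exists x.
  rewrite -(LmulVK (x, l%:Z) g); apply: Va' => //.
  have Vy := Va _ _ Vx (Vo _ Vw).
  have E : (Lmul (x, l%:Z) (Linv g)).2 = (l - k)%N%:Z by rewrite /= -subzn.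
  rewrite (surjective_pairing (Lmul _ _)) E; apply: IH; first by lia.
  by rewrite -E -surjective_pairing.
case=> x l Vx; case: (intP l) Vx => [|m|m] Vx; [exact: (pos 0%N)|exact: (pos m.+1)|].
rewrite -(LinvK (x, _)); apply: Vo'.
have E : (Linv (x, - m.+1%:Z)).2 = m.+1%:Z by rewrite /= opprK.
rewrite (surjective_pairing (Linv _)) E; apply: pos.
by rewrite -E -surjective_pairing; exact: Vo.
Qed.

Lemma nonzero_pi1_countable : countable [set V : SpL n p
  | SubL n p V /\ ~ pi1_zero n p V].
Proof.
have [e He] := Lnp_enum n p.
have H V : exists s, is_subgroupL V -> ~ pi1_zero n p V -> fin_generated e V s.
  have [[SV V0]|no] := pselect (is_subgroupL V /\ ~ pi1_zero n p V).
    by have [s Hs] := subgroup_fin_generated He SV V0; exists s.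
  by exists [::] => SV V0; exfalso; exact: no.
have [f Hf] := choice H.
apply/countable_injP; exists (pickle \o f) => V W /set_mem [SV V0] /set_mem [SW W0].
move=> /(pcan_inj pickleK) E.
have [V1 V2] := Hf V SV V0; have [W1 W2] := Hf W SW W0.
apply/funext => g; apply/idP/idP => Hg.
  by apply: V2 => //; rewrite E.
by apply: W2 => //; rewrite -E.
Qed.

(** Two perfect sets with countable complement contain each other: a point of one outside the other
    has a neighbourhood missing the latter, where the former would be both uncountable and contained
    in a countable complement. *)
Lemma perfect_kernel_SubL0 (K : set (SpL n p)) : (0 < n)%N ->
  is_perfect_kernel n p K -> K = @SubL0 n p.
Proof.
move=> n0 [KS pK cK]; have [e He] := Lnp_enum n p.
have cL := SpL_coords He.
have sep (V W : SpL n p) : (forall k, V (e k) = W (e k)) -> V = W.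
  by move=> VW; apply/funext => g; have [k <-] := He g.
have main (P D : set (SpL n p)) : perfect_set P -> closed D ->
    P `<=` SubL n p -> countable (SubL n p `\` D) -> P `<=` D.
  move=> pP cD PS cSD V PV; apply: contrapT => nDV.
  have /(coords_nbhs cL) [m mD] : nbhs V (~` D).
    by apply: open_nbhs_nbhs; split => //; exact: closed_openC.
  apply: (perfect_uncountable cL sep (m0 := m) pP PV).
  apply: sub_countable cSD; apply: subset_card_le => W [PW VW].
  by split; [exact: PS|exact: mD].
apply/seteqP; split; apply: main => //.
- exact: SubL0_closed.
- apply: sub_countable nonzero_pi1_countable; apply: subset_card_le => V [SV nV].
  by split => // V0; apply: nV.
- exact: SubL0_perfect.
- by case: pK.
- by move=> V [].
Qed.

End kernel.

Lemma IRS_0_star (R : realType) (n p : nat) (K : set (SpL n p)) : (0 < n)%N ->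
  is_perfect_kernel n p K -> IRS_0 R n p = IRS_star R n p K.
Proof.
move=> n0 /(perfect_kernel_SubL0 n0) ->.
have mS : measurable (SubL n p : set (Borel (SpL n p))).
  by apply: closed_borel; exact: SubL_closed.
have m0 : measurable (pi1_zero n p : set (Borel (SpL n p))).
  by apply: closed_borel; exact: pi1_zero_closed.
apply/seteqP; split=> mu [S1 [I1 P1]]; split => //; split => //.
  by apply/prob1I.
by case/(prob1I mu mS m0): P1.
Qed.

Theorem theorem3p3 (R : realType) (p n : nat) (hp : prime p) (hn : (0 < n)%N) :
  poulsen_simplex (IRS_tau R n p) /\
  forall K : set (SpL n p), is_perfect_kernel n p K ->
    IRS_0 R n p = IRS_star R n p K /\ poulsen_simplex (IRS_0 R n p).
Proof.
split=> [|K hK]; first exact: IRS_tau_poulsen.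
by split; [exact: IRS_0_star|exact: IRS_0_poulsen].
Qed.
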